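(* Let $k\ge2$ be an integer. With respect to the local limit topology, $\mathrm{GT}_k^n$ converges weakly to $\mathrm{GT}_k^\infty$ as $n\to\infty$.
   Context: Trees are rooted, unordered, with finite numbers of children, identified up to root- and parent-preserving bijections. For an integer $R\ge0$, $t|_R$ is the subtree of vertices at graph distance at most $R$ from the root; the local limit topology is induced by $d_{\mathrm{loc}}(t,s)=\exp[-\inf\{R\ge0:t|_R\ne s|_R\}]$. $k$-ary growing trees. $T_0$ is the single-vertex tree; for $n\ge1$, given $T_{n-1}$, view it as planted (a phantom edge is attached under the root), pick one of its edges (including the phantom edge) uniformly at random, place a new vertex on that edge and attach $k-1$ new leaves to this vertex; the result is $T_n$, a $k$-ary tree with $n$ internal (non-leaf) vertices. $\mathrm{GT}_k^n$ is the law of $T_n$. Negative Dirichlet multinomial law with parameters $(1;1/k,\dots,1/k)$: the law of $X=(X_1,\dots,X_{k-1})$ where, for integers $n_1,\dots,n_{k-1}\ge0$ and $N=n_1+\dots+n_{k-1}$, $$\mathbb P[X=(n_1,\dots,n_{k-1})]=\frac1k\,\frac1{1+N}\prod_{i=1}^{k-1}\frac{\Gamma(n_i+1/k)}{\Gamma(1/k)\,n_i!}.$$ $\mathrm{GT}_k^\infty$ is the law of the tree obtained from an infinite branch $v_0$ (root)$,v_1,v_2,\dots$ by attaching, for each $n\ge0$, the roots of $\tau_{n,1},\dots,\tau_{n,k-1}$ by edges to $v_n$, where $(X_n,\tau_{n,1},\dots,\tau_{n,k-1})_{n\ge0}$ are i.i.d., $X_n$ has the negative Dirichlet multinomial law with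 parameters $(1;1/k,\dots,1/k)$ and, given $X_n=(m_1,\dots,m_{k-1})$, the trees $\tau_{n,i}$ are independent with $\tau_{n,i}\sim\mathrm{GT}_k^{m_i}$. *)

(* Defs.v *)
From HB Require Import structures.
From mathcomp Require Import all_boot all_order all_algebra.
From mathcomp Require Import finmap generic_quotient.
From mathcomp Require Import all_classical all_reals all_analysis.

Set Implicit Arguments.
Unset Strict Implicit.
Unset Printing Implicit Defensive.
Import Order.TTheory GRing.Theory Num.Theory.
Import numFieldNormedType.Exports.
Local Open Scope classical_set_scope.
Local Open Scope ring_scope.
Local Open Scope quotient_scope.

(* A plane tree is given by its offspring function: the children of the vertex
   addressed by the word [u] are [rcons u i] for [i < t u], and the root is
   [[::]]. Values of [t] at words that are not vertices are irrelevant. Every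
   rooted tree with finite numbers of children is isomorphic to such a tree. *)
Definition ptree := seq nat -> nat.
HB.instance Definition _ := Choice.copy ptree (seq nat -> nat).

Definition child (t : ptree) (i : nat) : ptree := fun u => t (i :: u).

Fixpoint vertex (t : ptree) (u : seq nat) : bool :=
  if u is i :: w then (i < t [::])%N && vertex (child t i) w else true.

Definition parent (u : seq nat) : seq nat := take (size u).-1 u.

Definition iso (t s : ptree) : Prop :=
  exists f : seq nat -> seq nat,
    [/\ set_bij [set u | vertex t u] [set u | vertex s u] f,
        f [::] = [::] &
        forall u i, vertex t (rcons u i) -> parent (f (rcons u i)) = f u].

Lemma parent_rcons u i : parent (rcons u i) = u.
Proof. by rewrite /parent size_rcons /= -cats1 take_size_cat. Qed.

Lemma parentE u : u != [::] -> exists i, u = rcons (parent u) i.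
Proof. by case/lastP: u => // u i _; exists i; rewrite parent_rcons. Qed.

Lemma vertex_rcons t u i : vertex t (rcons u i) -> vertex t u.
Proof. by elim: u t => [|j u IH] t //= /andP[-> /IH]. Qed.

Lemma iso_rcons t s f u i :
  set_bij [set u | vertex t u] [set u | vertex s u] f -> f [::] = [::] ->
  vertex t (rcons u i) -> parent (f (rcons u i)) = f u ->
  exists j, f (rcons u i) = rcons (f u) j.
Proof.
move=> [_ finj _] f0 tui fui; rewrite -fui; apply: parentE.
apply/eqP => fui0; have := finj (rcons u i) [::].
rewrite !inE f0 fui0 => /(_ tui isT erefl).
by case: (u).
Qed.

Lemma iso_refl t : iso t t.
Proof.
exists id; split=> // [|u i _]; last exact: parent_rcons.
by split=> // u /=; exists u.
Qed.

Lemma iso_sym t s : iso t s -> iso s t.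
Proof.
move=> [f [fb f0 fp]]; have [fm finj fsurj] := fb.
have gP u : exists v, vertex s u -> vertex t v /\ f v = u.
  case su: (vertex s u); last by exists [::].
  by have [v tv fv] := fsurj u su; exists v.
pose g u := projT1 (cid (gP u)).
have gE u : vertex s u -> vertex t (g u) /\ f (g u) = u.
  by rewrite /g; case: cid => v /=.
have fK u v : vertex t u -> vertex t v -> f u = f v -> u = v.
  by move=> tu tv; apply: finj; rewrite inE.
have g0 : g [::] = [::].
  by have [//|tg fg] := gE [::]; apply: fK => //; rewrite f0.
exists g; split=> //.
- split=> [u su|u v|u tu] /=.
  + by have [] := gE u su.
  + by rewrite !inE /= => /gE[_ {2}<-] /gE[_ {2}<-] ->.
  + have sfu : vertex s (f u) by exact: fm.
    by exists (f u) => //; have [? ?] := gE _ sfu; apply: fK.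
- move=> u i sui; have su := vertex_rcons sui.
  have [tg fg] := gE _ sui; have [tgu fgu] := gE _ su.
  have gn0 : g (rcons u i) != [::].
    by apply/eqP => gn; move: fg; rewrite gn f0; case: (u).
  have [j gj] := parentE gn0.
  have tp : vertex t (parent (g (rcons u i))).
    by apply: (@vertex_rcons _ _ j); rewrite -gj.
  apply: fK => //; rewrite fgu -(fp _ j) -gj// fg; exact: parent_rcons.
Qed.

Lemma iso_trans t s r : iso t s -> iso s r -> iso t r.
Proof.
move=> [f [fb f0 fp]] [g [gb g0 gp]]; exists (g \o f); split.
- exact: set_bij_comp fb gb.
- by rewrite /= f0.
- move=> u i tui /=; have [j fj] := iso_rcons fb f0 tui (fp _ _ tui).
  rewrite fj gp// -fj; have [fm _ _] := fb; exact: fm.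
Qed.

Definition isob (t s : ptree) : bool := `[< iso t s >].

Lemma isob_refl : reflexive isob.
Proof. by move=> t; apply/asboolP; exact: iso_refl. Qed.

Lemma isob_sym : symmetric isob.
Proof. by move=> t s; apply/asboolP/asboolP; exact: iso_sym. Qed.

Lemma isob_trans : transitive isob.
Proof.
move=> t s r /asboolP st /asboolP tr; apply/asboolP; exact: iso_trans st tr.
Qed.

Canonical isob_equiv := EquivRel isob isob_refl isob_sym isob_trans.

Definition tree := {eq_quot isob_equiv}.
HB.instance Definition _ := Choice.on tree.

Definition tree_of (t : ptree) : tree := (\pi_tree t)%qT.
Definition rep (x : tree) : ptree := repr (x : {eq_quot isob_equiv}).

Definition leaf : ptree := fun=> 0%N.

HB.instance Definition _ := isPointed.Build tree (tree_of leaf).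

Definition trunc (r : nat) (t : ptree) : ptree :=
  fun u => if (size u < r)%N then t u else 0%N.

Definition restr (r : nat) (x : tree) : tree := tree_of (trunc r (rep x)).

Definition dloc (R : realType) (x y : tree) : R :=
  fine (expeR (- ereal_inf
    [set (r%:R)%:E | r in [set r : nat | restr r x <> restr r y]])).

Section dloc.
Variable R : realType.
Implicit Types x y z : tree.

Let S x y : set (\bar R) :=
  [set (r%:R)%:E | r in [set r : nat | restr r x <> restr r y]].

Let S_ge0 x y : (0 <= ereal_inf (S x y))%E.
Proof. by apply: le_ereal_inf_tmp => _ [r _ <-]; rewrite lee_fin. Qed.

Let expeR_S_fin x y : (expeR (- ereal_inf (S x y)) \is a fin_num)%E.
Proof.
rewrite ge0_fin_numE ?expeR_ge0//; apply: (@le_lt_trans _ _ 1%:E%E).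
  by rewrite -expeR0 lee_expeR leeNl oppe0 S_ge0.
by rewrite ltry.
Qed.

Lemma dlocxx x : dloc R x x = 0.
Proof.
rewrite /dloc (_ : [set r | _] = set0) ?image_set0 ?ereal_inf0//.
by rewrite -subset0 => r /=.
Qed.

Lemma dloc_sym x y : dloc R x y = dloc R y x.
Proof.
rewrite /dloc; congr (fine (expeR (- ereal_inf (_ @` _)))).
by apply/seteqP; split=> r /= /nesym.
Qed.

Lemma dloc_ge0 x y : 0 <= dloc R x y.
Proof. by rewrite /dloc fine_ge0// expeR_ge0. Qed.

Lemma dloc_ultra x y z : dloc R x z <= Num.max (dloc R x y) (dloc R y z).
Proof.
suff : (ereal_inf (S x y) <= ereal_inf (S x z))%E \/
       (ereal_inf (S y z) <= ereal_inf (S x z))%E.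
  by rewrite le_max => -[] H; apply/orP; [left|right];
     rewrite /dloc fine_le ?expeR_S_fin// lee_expeR leeN2.
have [/ltW ?|h1] := ltP (ereal_inf (S x y)) (ereal_inf (S y z)); [left|right];
  apply: le_ereal_inf_tmp => _ [r /= rxz <-].
- have [rxy|rxy] := pselect (restr r x = restr r y).
    apply: le_trans (ereal_inf_lbound _); first eassumption.
    by exists r => //=; rewrite -rxy.
  by apply: ereal_inf_lbound; exists r.
- have [ryz|ryz] := pselect (restr r y = restr r z).
    apply: le_trans (ereal_inf_lbound _); first eassumption.
    by exists r => //=; rewrite ryz.
  by apply: ereal_inf_lbound; exists r.
Qed.

End dloc.

Definition loctree (R : realType) : Type := tree.
HB.instance Definition _ R := Pointed.copy (loctree R) tree.

Section loctree_topology.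
Variable R : realType.

Definition loctree_ball (x : loctree R) (e : R) : set (loctree R) :=
  [set y | dloc R x y < e].

Definition loctree_ent : set_system (loctree R * loctree R) :=
  entourage_ loctree_ball.

HB.instance Definition _ := hasNbhs.Build (loctree R) (nbhs_ loctree_ent).

Let nbhsE : nbhs = nbhs_ loctree_ent. Proof. by []. Qed.

Let ball_center x (e : R) : 0 < e -> loctree_ball x e x.
Proof. by move=> e0; rewrite /loctree_ball /= dlocxx. Qed.

Let ball_sym x y (e : R) : loctree_ball x e y -> loctree_ball y e x.
Proof. by rewrite /loctree_ball /= dloc_sym. Qed.

Let ball_triangle x y z (e1 e2 : R) :
  loctree_ball x e1 y -> loctree_ball y e2 z -> loctree_ball x (e1 + e2) z.
Proof.
rewrite /loctree_ball /= => h1 h2; apply: le_lt_trans (dloc_ultra R x y z) _.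
have e1_gt0 := le_lt_trans (dloc_ge0 R x y) h1.
have e2_gt0 := le_lt_trans (dloc_ge0 R y z) h2.
by rewrite gt_max (lt_le_trans h1) ?(lt_le_trans h2)// ?lerDl ?lerDr ltW.
Qed.

Let entE : loctree_ent = entourage_ loctree_ball. Proof. by []. Qed.

HB.instance Definition _ := @Nbhs_isPseudoMetric.Build R (loctree R)
  loctree_ent nbhsE loctree_ball ball_center ball_sym ball_triangle entE.

End loctree_topology.

Definition borel (T : ptopologicalType) := g_sigma_algebraType (@open T).

Definition weakly_converges (R : realType) (T : ptopologicalType)
    (mu_ : nat -> probability (borel T) R) (mu : probability (borel T) R) :=
  forall f : T -> R, continuous f -> bounded_fun f ->
    (\int[mu_ n]_x (f x)%:E @[n --> \oo] --> \int[mu]_x (f x)%:E)%E.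

Definition node (n : nat) (c : nat -> ptree) : ptree :=
  fun u => if u is i :: w then c i w else n.

Definition vertices (t : ptree) : {fset seq nat} :=
  fset_set [set u | vertex t u].

(* The edges of the planted tree [t] are identified with the vertices of [t]:
   [v] stands for the edge just below it, the phantom edge if [v] is the root.
   [grow k t v] places a new vertex on that edge; its children are the former
   subtree above the edge and [k - 1] new leaves. *)
Fixpoint grow (k : nat) (t : ptree) (v : seq nat) : ptree :=
  if v is i :: w then
    node (t [::]) (fun j => if j == i then grow k (child t j) w else child t j)
  else node k (fun j => if j == 0%N then t else leaf).

(* Weighted plane trees [(w, t)], possibly with repetitions: the law of a plane
   representative of [T_n] is the sum of the Dirac masses [w * delta_t]. *)
Fixpoint growth (R : realType) (k n : nat) : seq ({nonneg R} * ptree) :=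
  if n is m.+1 then
    [seq ((p.1%:num / (#|` vertices p.2|)%:R)%:nng, grow k p.2 v)
       | p <- growth R k m, v <- vertices p.2]
  else [:: (1%:nng, leaf)].

Definition growth_mass (R : realType) (k n i : nat) :
    {measure set (borel (loctree R)) -> \bar R} :=
  let p := nth (0%:nng, leaf) (growth R k n) i in
  mscale p.1 (dirac (tree_of p.2 : borel (loctree R))).

Definition GT (R : realType) (k n : nat) : set (borel (loctree R)) -> \bar R :=
  msum (growth_mass R k n) (size (growth R k n)).

HB.instance Definition _ (R : realType) (k n : nat) :=
  Measure.copy (GT k n) (msum (growth_mass R k n) (size (growth R k n))).

Lemma finite_vertex_node n c :
  (forall i, (i < n)%N -> finite_set [set u | vertex (c i) u]) ->
  finite_set [set u | vertex (node n c) u].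
Proof.
move=> cfin; apply: (@sub_finite_set _ _ ([set [::]] `|`
    \bigcup_(i in `I_n) (cons i @` [set u | vertex (c i) u]))).
  by move=> [|i w] /=; [left|case/andP => ni ciw; right; exists i => //; exists w].
rewrite finite_setU; split=> //; apply: bigcup_finite => // i /cfin ?.
exact: finite_image.
Qed.

Lemma finite_vertex_child t i : (i < t [::])%N ->
  finite_set [set u | vertex t u] -> finite_set [set u | vertex (child t i) u].
Proof.
move=> it /(finite_image (drop 1)); apply: sub_finite_set => u /= tiu.
by exists (i :: u) => //=; [rewrite it|rewrite drop0].
Qed.

Lemma finite_vertex_grow k t v :
  finite_set [set u | vertex t u] -> finite_set [set u | vertex (grow k t v) u].
Proof.
have leaffin : finite_set [set u | vertex leaf u].
  by apply: (@sub_finite_set _ _ [set [::]]) => // -[].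
elim: v t => [|i v IH] t tfin /=; apply: finite_vertex_node => j jt.
  by case: ifP.
by case: ifP => _; [apply: IH|]; exact: finite_vertex_child.
Qed.

Lemma growth_finite (R : realType) k n (p : {nonneg R} * ptree) :
  p \in growth R k n -> finite_set [set u | vertex p.2 u].
Proof.
elim: n p => [|n IH] p /=.
  by rewrite inE => /eqP ->; apply: (@sub_finite_set _ _ [set [::]]) => // -[].
by case/allpairsPdep => q [v [/IH qfin _ ->]]; exact: finite_vertex_grow.
Qed.

Lemma growth_total (R : realType) k n :
  \sum_(p <- growth R k n) p.1%:num = 1 :> R.
Proof.
elim: n => [|n IH]; first by rewrite big_seq1.
rewrite /= big_allpairs_dep/= -[RHS]IH big_seq [RHS]big_seq.
apply: eq_bigr => p /growth_finite pfin.
rewrite big_const_seq count_predT iter_addr_0 -mulr_natr divfK//.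
rewrite pnatr_eq0 cardfs_eq0; apply/eqP => /fsetP/(_ [::]).
by rewrite in_fset_set// inE mem_set.
Qed.

Lemma GT_setT (R : realType) k n : @GT R k n setT = 1%E.
Proof.
rewrite /GT /msum /growth_mass /= /mscale /= /dirac -(growth_total R k n).
rewrite (big_nth (0%:nng, leaf)) big_mkord -sumEFin.
by apply: eq_bigr => i _; rewrite indicT mule1.
Qed.

HB.instance Definition _ (R : realType) (k n : nat) :=
  Measure_isProbability.Build _ _ _ (@GT R k n) (GT_setT R k n).

Definition Gamma (R : realType) (a : R) : R :=
  \int[lebesgue_measure]_(x in `]0, +oo[) (x `^ (a - 1) * expR (- x)).

Definition neg_dirichlet_multinomial (R : realType) (k : nat)
    (m : k.-1.-tuple nat) : R :=
  k%:R^-1 * (1 + (\sum_(i < k.-1) tnth m i)%:R)^-1 *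
  \prod_(i < k.-1)
    (Gamma ((tnth m i)%:R + k%:R^-1) / (Gamma k%:R^-1 * (tnth m i)`!%:R)).

Definition independent_seq d d' (Om : measurableType d) (T : measurableType d')
    (R : realType) (P : probability Om R) (Y : nat -> Om -> T) :=
  forall (J : {fset nat}) (B : nat -> set T), (forall n, measurable (B n)) ->
    fine (P (\bigcap_(n in [set` J]) Y n @^-1` B n)) =
    \prod_(n <- J) fine (P (Y n @^-1` B n)).

(* [v_n] is the word of [n] zeros; its children are [v_(n+1)] and the roots of
   [tau n 0], ..., [tau n (k - 2)], in this order. *)
Fixpoint spine (k : nat) (tau : nat -> nat -> ptree) (u : seq nat) : nat :=
  match u with
  | [::] => k
  | 0 :: w => spine k (fun n => tau n.+1) w
  | i.+1 :: w => tau 0%N i w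
  end.

Definition spine_tree (k : nat) (tau : nat -> k.-1.-tuple tree) : tree :=
  tree_of (spine k (fun n i => rep (nth (tree_of leaf) (tau n) i))).

(* The identity of the laws of the [(X n, tau n)] follows from the second and
   third conditions, which determine them. In the last condition the set is a
   preimage under a measurable map, which is not proved here. *)
Definition is_GT_infinity (R : realType) (k : nat)
    (mu : probability (borel (loctree R)) R) :=
  exists (d : measure_display) (Om : measurableType d) (P : probability Om R)
    (X : nat -> {RV P >-> k.-1.-tuple nat})
    (tau : nat -> {RV P >-> k.-1.-tuple (borel (loctree R))}),
  [/\ independent_seq P (fun n w => (X n w, tau n w)),
      forall n m, P (X n @^-1` [set m]) = (neg_dirichlet_multinomial R m)%:E,
      forall n (m : k.-1.-tuple nat) (A : 'I_k.-1 -> set (borel (loctree R))),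
        (forall i, measurable (A i)) ->
        fine (P (X n @^-1` [set m] `&`
                 [set w | forall i, A i (tnth (tau n w) i)])) =
        fine (P (X n @^-1` [set m])) *
        \prod_(i < k.-1) fine (GT k (tnth m i) (A i)) &
      forall A, measurable A ->
        mu A = P [set w | A (spine_tree (fun n => tau n w))]].

(* Main.v *)
Require Import Defs.
From HB Require Import structures.
From mathcomp Require Import finmap generic_quotient zify ring lra.
From mathcomp Require Import all_boot all_order all_algebra.
From mathcomp Require Import all_classical all_reals all_analysis.
From mathcomp Require Import measurable_realfun.

(** The growth rule is compatible with the decomposition of a tree at its root.
    Write [k = K.+1]. After [n.+1] steps the root has [k] subtrees and, given
    their sizes, these are independent grown trees, because a step either puts
    the whole tree below a new root or is a growth step of one subtree
    ([gexp_child_prod]). The vector [m] of the sizes of the last [K] subtrees is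
    a Markov chain in [n], and the law [p n] of this chain satisfies a linear
    recurrence ([sexp_indic_rec]) which, for [n >= |m|], reads
      (k (n+1) + 1) p (n+1) m = [m = 0] + (k (n - |m|) + 1) p n m
                          + sum_(i | m_i > 0) (k (m_i - 1) + 1) p n (m - e_i).
    The negative Dirichlet multinomial weights solve the stationary form of this
    recurrence, by the functional equation of the Gamma function
    ([neg_dirichlet_rec]), and the recurrence is contracting, so that [p n m]
    tends to them ([lowlim_sexp]). In the limit the first subtree of the root is
    thus a large grown tree, and the others are independent of it, with the
    sizes prescribed at a vertex of the infinite branch. The tree built along
    the branch has the same recursive structure, so induction on the radius
    compares the balls of the two trees ([lowlim_spine]).

    All estimates bound lower limits from below. If the probabilities of all
    balls have lower limits at least those of the limit tree, then so do those
    of all open sets, which are countable disjoint unions of balls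
    ([lowlim_open]), hence the integrals of all bounded continuous functions, by
    integrating over their level sets ([lowlim_Rintegral]). Applied to [f] and
    [- f], shifted to be nonnegative, this is weak convergence. Working with
    lower limits makes every infinite sum harmless, since countable additivity
    reduces it to finitely many terms ([lowlim_bigcup]). *)

Set Implicit Arguments.
Unset Strict Implicit.
Unset Printing Implicit Defensive.
(* so that [iso] is the isomorphism of trees *)
Import Defs.
Import Order.TTheory GRing.Theory Num.Theory.
Import numFieldNormedType.Exports.
Local Open Scope classical_set_scope.
Local Open Scope ring_scope.
Local Open Scope quotient_scope.

(** * Isomorphism classes and balls *)

Lemma tree_ofP (t s : ptree) : tree_of t = tree_of s <-> iso t s.
Proof.
rewrite /tree_of; split=> [/eqP|ts].
  by rewrite eqmodE => /asboolP.
by apply/eqP; rewrite eqmodE; apply/asboolP.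
Qed.

Lemma tree_of_rep (x : tree) : tree_of (rep x) = x.
Proof. exact: reprK. Qed.

Lemma iso_rep (t : ptree) : iso (rep (tree_of t)) t.
Proof. by apply/tree_ofP; rewrite tree_of_rep. Qed.

(** An isomorphism preserves depth, hence commutes with truncation. *)
Lemma vertex_size_iso t s (f : seq nat -> seq nat) :
  set_bij [set u | vertex t u] [set u | vertex s u] f -> f [::] = [::] ->
  (forall u i, vertex t (rcons u i) -> parent (f (rcons u i)) = f u) ->
  forall u, vertex t u -> size (f u) = size u.
Proof.
move=> fb f0 fp; elim/last_ind => [|u i IH] tui; first by rewrite f0.
have [j ->] := iso_rcons fb f0 tui (fp _ _ tui).
by rewrite !size_rcons IH//; exact: vertex_rcons tui.
Qed.

Lemma vertex_trunc r t u : vertex (trunc r t) u = (size u <= r)%N && vertex t u.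
Proof.
elim: u r t => [//|i u IH] r t /=.
case: r => [|r] /=; first by rewrite /trunc.
have -> : child (trunc r.+1 t) i = trunc r (child t i) by [].
by rewrite IH /trunc /= ltnS andbCA.
Qed.

Lemma iso_trunc r t s : iso t s -> iso (trunc r t) (trunc r s).
Proof.
move=> [f [fb f0 fp]]; have fsz := vertex_size_iso fb f0 fp.
have [fm finj fsurj] := fb.
exists f; split=> //; last first.
  by move=> u i; rewrite vertex_trunc => /andP[_]; exact: fp.
split.
- move=> u /=; rewrite !vertex_trunc => /andP[ur tu].
  by rewrite fsz// ur; exact: fm.
- move=> u v; rewrite !inE /= !vertex_trunc => /andP[_ tu] /andP[_ tv].
  by apply: finj; rewrite inE.
- move=> u /=; rewrite vertex_trunc => /andP[ur /fsurj[v tv fv]].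
  by exists v => //=; rewrite vertex_trunc tv -(fsz v)// fv ur.
Qed.

Lemma restr_tree_of r t : restr r (tree_of t) = tree_of (trunc r t).
Proof. by apply/tree_ofP/iso_trunc; exact: iso_rep. Qed.

Lemma restr_restr r r' x : (r' <= r)%N -> restr r' (restr r x) = restr r' x.
Proof.
move=> rr; rewrite {2}/restr restr_tree_of /restr; congr tree_of.
apply/funext => u; rewrite /trunc; case: ifP => // ur.
by rewrite (leq_trans ur rr).
Qed.

Lemma restr_nested r r' x y : (r' <= r)%N ->
  restr r x = restr r y -> restr r' x = restr r' y.
Proof. by move=> rr xy; rewrite -(restr_restr x rr) xy restr_restr. Qed.

Lemma restr0 x : restr 0 x = tree_of leaf.
Proof. by []. Qed.

Lemma iso_node n (c d : nat -> ptree) :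
  (forall i, (i < n)%N -> iso (c i) (d i)) -> iso (node n c) (node n d).
Proof.
move=> cd.
have /(_ _)/cid-/all_sig[f fP] : forall i, exists f : seq nat -> seq nat,
    (i < n)%N ->
    [/\ set_bij [set u | vertex (c i) u] [set u | vertex (d i) u] f,
        f [::] = [::] &
        forall u j, vertex (c i) (rcons u j) -> parent (f (rcons u j)) = f u].
  move=> i; case: (ltnP i n) => [/cd[f fP]|_]; first by exists f.
  by exists id.
(* The isomorphisms of the subtrees are glued below a fixed root. *)
exists (fun u => if u is i :: w then i :: f i w else [::]); split=> //.
- split.
  + move=> [|i u] //= /andP[iin cu]; rewrite iin /=.
    by have [[fm _ _] _ _] := fP i iin; exact: fm.
  + move=> [|i u] [|j v] //; rewrite !inE /= => /andP[iin cu] /andP[jn cv].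
    move=> [ij]; rewrite -ij in jn cv *; have [[_ finj _] _ _] := fP i iin.
    by move=> fuv; congr cons; apply: finj => //; rewrite inE.
  + move=> [|i u] /=; first by exists [::].
    move=> /andP[iin du]; have [[_ _ fsurj] _ _] := fP i iin.
    have [v cv fv] := fsurj u du; exists (i :: v) => /=; first by rewrite iin.
    by rewrite fv.
- move=> [|i u] j /=.
    by rewrite andbT => jn; have [_ -> _] := fP j jn.
  move=> /andP[iin cu]; have [fb f0 fp] := fP i iin.
  have [l fl] := iso_rcons fb f0 cu (fp _ _ cu).
  by rewrite -(fp _ _ cu) fl -rcons_cons !parent_rcons.
Qed.

Lemma node_child (t : ptree) : t = node (t [::]) (child t).
Proof. by apply/funext; case. Qed.

Lemma trunc_node r n c : trunc r.+1 (node n c) = node n (fun i => trunc r (c i)).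
Proof. by apply/funext; case. Qed.

(** [node] on isomorphism classes; by [nodeT_ext] it does not depend on the
    representatives. *)
Definition nodeT (n : nat) (x : nat -> tree) : tree :=
  tree_of (node n (fun i => rep (x i))).

Lemma nodeT_ext n x y : (forall i, (i < n)%N -> x i = y i) ->
  nodeT n x = nodeT n y.
Proof.
by move=> xy; apply/tree_ofP/iso_node => i /xy ->; exact: iso_refl.
Qed.

Lemma tree_of_node n c : tree_of (node n c) = nodeT n (fun i => tree_of (c i)).
Proof. by apply/tree_ofP/iso_node => i _; apply/iso_sym/iso_rep. Qed.

Lemma restr_nodeT r n x :
  restr r.+1 (nodeT n x) = nodeT n (fun i => restr r (x i)).
Proof. by rewrite restr_tree_of trunc_node tree_of_node. Qed.

(** A ball of radius [r.+1] is determined by the finite list of the balls of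
    radius [r] at the children of the root, and there are countably many lists
    of numbers. *)
Lemma restr_countable r : exists g : nat -> tree,
  forall x, exists i, g i = restr r x.
Proof.
elim: r => [|r [g gP]]; first by exists (fun=> tree_of leaf) => x; exists 0%N.
exists (fun i => if @unpickle (seq nat) i is Some l
  then nodeT (size l) (fun j => g (nth 0%N l j)) else tree_of leaf).
move=> x; have [c cP] := choice gP.
pose t := rep x; pose y j := tree_of (child t j).
exists (pickle [seq c (y j) | j <- iota 0 (t [::])]); rewrite pickleK.
have -> : x = nodeT (t [::]) y by rewrite -tree_of_node -node_child tree_of_rep.
rewrite size_map size_iota restr_nodeT; apply: nodeT_ext => j jt.
by rewrite (nth_map 0%N) ?size_iota// nth_iota// cP.
Qed.

(** A number for the ball of radius [r], chosen as a function of the ball alone.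
    Sums over balls then become sums over numbers. *)
Definition ball_code (r : nat) (x : tree) : nat :=
  xget 0%N [set i | projT1 (cid (restr_countable r)) i = restr r x].

Lemma codeP r x y : ball_code r x = ball_code r y <-> restr r x = restr r y.
Proof.
split=> [|xy]; last by rewrite /ball_code xy.
rewrite /ball_code; case: cid => g gP /=.
have ex z : exists i, [set i | g i = restr r z] i by exact: gP.
by move=> e; rewrite -(xgetPex 0%N (ex x)) e (xgetPex 0%N (ex y)).
Qed.

Lemma code_nested r r' x y : (r' <= r)%N ->
  ball_code r x = ball_code r y -> ball_code r' x = ball_code r' y.
Proof. by rewrite !codeP; exact: restr_nested. Qed.

(** The balls at the children determine the ball at the root: this drives the
    induction on the radius. *)
Lemma code_nodeT r n x y :
  (forall i, (i < n)%N -> ball_code r (x i) = ball_code r (y i)) ->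
  ball_code r.+1 (nodeT n x) = ball_code r.+1 (nodeT n y).
Proof.
move=> xy; apply/codeP; rewrite !restr_nodeT; apply: nodeT_ext => i /xy.
by rewrite codeP.
Qed.

(** * Growth and the subtrees of the root *)

Lemma vertices_perm (t : ptree) : finite_set [set u | vertex t u] ->
  perm_eq (vertices t)
    ([::] :: [seq i :: w | i <- iota 0 (t [::]), w <- vertices (child t i)]).
Proof.
move=> tfin; apply: uniq_perm; first exact: fset_uniq.
- rewrite /=; apply/andP; split.
    by apply/negP => /allpairsPdep[i [w []]].
  apply: allpairs_uniq_dep; first exact: iota_uniq.
    by move=> i _; exact: fset_uniq.
  by move=> [i u] [j v] _ _ /= [-> ->].
- move=> [|i w]; rewrite in_fset_set// ?inE /= mem_setE //=.
  apply/andP/allpairsPdep => [[it tiw]|].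
    exists i, w; split=> //; first by rewrite mem_iota.
    by rewrite in_fset_set ?mem_setE//; exact: finite_vertex_child.
  move=> [j [v [+ + [-> ->]]]]; rewrite mem_iota/= add0n => jt.
  by rewrite in_fset_set ?mem_setE//; exact: finite_vertex_child.
Qed.

Lemma big_vertices (R : nmodType) (t : ptree) (F : seq nat -> R) :
  finite_set [set u | vertex t u] ->
  \sum_(v <- vertices t) F v =
  F [::] + \sum_(i < t [::]) \sum_(w <- vertices (child t i)) F (nat_of_ord i :: w).
Proof.
move=> /vertices_perm tp; rewrite (perm_big _ tp) /= big_cons; congr (_ + _).
by rewrite big_allpairs_dep/= -(big_mkord xpredT
  (fun i => \sum_(w <- vertices (child t i)) F (i :: w))) /index_iota subn0.
Qed.

Lemma card_vertices (t : ptree) : finite_set [set u | vertex t u] ->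
  #|` vertices t| = (1 + \sum_(i < t [::]) #|` vertices (child t i)|)%N.
Proof.
move=> tfin; have cardE (s : ptree) : #|` vertices s| = (\sum_(v <- vertices s) 1)%N.
  by rewrite big_const_seq count_predT iter_addn_0 mul1n.
rewrite cardE [LHS](big_vertices (fun=> 1%N) tfin); congr addn.
by apply: eq_bigr => i _; rewrite cardE.
Qed.

Lemma finite_vertex_leaf : finite_set [set u | vertex leaf u].
Proof. by apply: (@sub_finite_set _ _ [set [::]]) => // -[]. Qed.

Lemma card_vertices_leaf : #|` vertices leaf| = 1%N.
Proof. by rewrite card_vertices ?big_ord0//; exact: finite_vertex_leaf. Qed.

(** Whatever the edge, a step adds one internal vertex and [K] leaves. *)
Lemma card_vertices_grow K (t : ptree) v : finite_set [set u | vertex t u] ->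
  vertex t v -> #|` vertices (grow K.+1 t v)| = (#|` vertices t| + K.+1)%N.
Proof.
elim: v t => [|i w IH] t tfin /=.
  move=> _; rewrite card_vertices; last exact: (@finite_vertex_grow _ _ [::]).
  rewrite /= big_ord_recl/= (_ : child _ _ = t)//.
  rewrite (eq_bigr (fun=> 1%N)); last by move=> j _; exact: card_vertices_leaf.
  by rewrite sum_nat_const card_ord muln1; lia.
move=> /andP[it tiw].
rewrite card_vertices; last exact: (@finite_vertex_grow _ _ (i :: w)).
rewrite (card_vertices tfin) /=.
rewrite (bigD1 (Ordinal it))//= [X in (_ + X + _)%N](bigD1 (Ordinal it))//=.
rewrite {1}/child /= eqxx.
rewrite (IH (child t i))//; last exact: finite_vertex_child.
rewrite -!addnA; do 2 congr addn; rewrite addnC; congr addn.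
by apply: eq_bigr => j ji; rewrite /child /= ifN.
Qed.

Section growth_expectation.
Variables (R : realType) (K : nat).
Local Notation k := K.+1.
Implicit Types (n : nat) (F G : ptree -> R).

(** Expectation with respect to the weighted list [growth R k n]. *)
Definition gexp n F : R := \sum_(p <- growth R k n) p.1%:num * F p.2.

(** The number of edges to choose from depends on [n] only, which is what makes
    the recurrences below linear. *)
Lemma growth_card n (p : {nonneg R} * ptree) :
  p \in growth R k n -> #|` vertices p.2| = (k * n + 1)%N.
Proof.
elim: n p => [|n IH] p /=.
  by rewrite inE => /eqP ->/=; rewrite card_vertices_leaf muln0.
case/allpairsPdep => q [v [qn + ->]] /=; have qfin := growth_finite qn.
rewrite in_fset_set// mem_setE => qv; rewrite card_vertices_grow// IH//; lia.
Qed.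

Lemma growth_root n (p : {nonneg R} * ptree) :
  p \in growth R k n.+1 -> p.2 [::] = k.
Proof.
elim: n p => [|n IH] p.
  case/allpairsPdep => q [v []]; rewrite inE => /eqP ->/=.
  rewrite in_fset_set; last exact: finite_vertex_leaf.
  by rewrite mem_setE; case: v => // _ ->.
by case/allpairsPdep => q [[|i w] [/IH qk _ ->]].
Qed.

Lemma eq_gexp n F G : (forall p, p \in growth R k n -> F p.2 = G p.2) ->
  gexp n F = gexp n G.
Proof.
by move=> FG; rewrite /gexp big_seq [RHS]big_seq; apply: eq_bigr => p /FG ->.
Qed.

Lemma ler_gexp n F G : (forall p, p \in growth R k n -> F p.2 <= G p.2) ->
  gexp n F <= gexp n G.
Proof.
move=> FG; rewrite /gexp big_seq [leRHS]big_seq; apply: ler_sum => p /FG ?.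
by rewrite ler_wpM2l.
Qed.

Lemma gexpD n F G : gexp n (fun t => F t + G t) = gexp n F + gexp n G.
Proof. by rewrite /gexp -big_split; apply: eq_bigr => p _; rewrite mulrDr. Qed.

Lemma gexp_sum n (I : Type) (r : seq I) (F : I -> ptree -> R) :
  gexp n (fun t => \sum_(i <- r) F i t) = \sum_(i <- r) gexp n (F i).
Proof. by rewrite /gexp exchange_big; apply: eq_bigr => p _; rewrite mulr_sumr. Qed.

Lemma gexpZ n c F : gexp n (fun t => c * F t) = c * gexp n F.
Proof. by rewrite /gexp mulr_sumr; apply: eq_bigr => p _; rewrite mulrCA. Qed.

Lemma gexp_cst n c : gexp n (fun=> c) = c.
Proof. by rewrite /gexp -mulr_suml growth_total mul1r. Qed.

Lemma gexp_ge0 n F : (forall t, 0 <= F t) -> 0 <= gexp n F.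
Proof. by move=> F0; apply: sumr_ge0 => p _; exact: mulr_ge0. Qed.

Lemma gexp_le1 n F : (forall t, F t <= 1) -> gexp n F <= 1.
Proof. by move=> F1; rewrite -[leRHS](gexp_cst n 1); apply: ler_gexp. Qed.

Lemma gexp0 F : gexp 0 F = F leaf.
Proof. by rewrite /gexp /= big_seq1 mul1r. Qed.

(** The dual of a growth step, acting on functionals; by [gexp_sum_grow] it is
    the step up to the number of edges. *)
Definition sum_grow F (t : ptree) : R :=
  \sum_(v <- vertices t) F (grow k t v).

Lemma gexp_sum_grow n F :
  gexp n (sum_grow F) = (k * n + 1)%:R * gexp n.+1 F.
Proof.
rewrite /gexp /= big_allpairs_dep/= mulr_sumr big_seq [RHS]big_seq.
apply: eq_bigr => p pn /=; rewrite -!mulr_sumr (growth_card pn).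
by rewrite mulrC mulrCA mulrA mulfVK ?pnatr_eq0 ?addn1 // mulrC.
Qed.

(* A vector [m] lists the sizes of the last [K] of the [k] subtrees of the root
   of a tree of size [n.+1]; the first subtree has size [n - total_size m]. *)
Implicit Types (m : K.-tuple nat) (g h : K.-tuple nat -> R).

Definition total_size m : nat := \sum_(i < K) tnth m i.
Definition incr_size m (i : 'I_K) : K.-tuple nat :=
  [tuple (tnth m j + (j == i))%N | j < K].
Definition decr_size m (i : 'I_K) : K.-tuple nat :=
  [tuple (tnth m j - (j == i))%N | j < K].
Definition zero_sizes : K.-tuple nat := [tuple 0%N | _ < K].

Lemma total_incr m i : total_size (incr_size m i) = (total_size m).+1.
Proof.
rewrite /total_size (eq_bigr (fun j => tnth m j + (j == i))%N); last first.
  by move=> j _; rewrite tnth_mktuple.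
rewrite big_split/= [X in (_ + X)%N](bigD1 i)//= eqxx.
rewrite [X in (_ + (_ + X))%N]big1 ?addn0 ?addn1//.
by move=> j /negbTE ->.
Qed.

Lemma total_zero : total_size zero_sizes = 0%N.
Proof. by rewrite /total_size big1// => i _; rewrite tnth_mktuple. Qed.

Lemma incrK m i : decr_size (incr_size m i) i = m.
Proof. by apply: eq_from_tnth => j; rewrite !tnth_mktuple addnK. Qed.

Lemma decrK m i : (0 < tnth m i)%N -> incr_size (decr_size m i) i = m.
Proof.
move=> mi; apply: eq_from_tnth => j; rewrite !tnth_mktuple.
by case: eqVneq => [->|_]; rewrite ?subnK// subn0 addn0.
Qed.

Lemma incr_gt0 m i : (0 < tnth (incr_size m i) i)%N.
Proof. by rewrite tnth_mktuple eqxx addn1. Qed.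

(** Expectation for the size vector after [n.+1] growth steps, defined as for a
    Markov chain. A new root makes the previous tree its first subtree, hence
    the vector [zero_sizes]; otherwise a subtree of size [j] is the one that
    grows with probability proportional to its number of edges, [k * j + 1].
    That this is the law of the actual sizes is part of [gexp_child_prod]. *)
Fixpoint sexp n g : R :=
  if n is n'.+1 then
    (k * n + 1)%:R^-1 * (g zero_sizes + sexp n' (fun m =>
      (k * (n' - total_size m) + 1)%:R * g m +
      \sum_(i < K) (k * tnth m i + 1)%:R * g (incr_size m i)))
  else g zero_sizes.

(** The chain stays among the vectors of total size at most [n]. *)
Lemma eq_sexp n g h : (forall m, (total_size m <= n)%N -> g m = h m) ->
  sexp n g = sexp n h.
Proof.
elim: n g h => [|n IH] g h gh; first by rewrite /= gh// total_zero.
rewrite /= gh ?total_zero//; congr (_ * (_ + _)); apply: IH => m mn.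
rewrite gh ?(leq_trans mn)//; congr (_ + _); apply: eq_bigr => i _.
by rewrite gh// total_incr.
Qed.

Lemma ler_sexp n g h : (forall m, g m <= h m) -> sexp n g <= sexp n h.
Proof.
elim: n g h => [|n IH] g h gh //=; rewrite ler_wpM2l ?invr_ge0//.
rewrite lerD//; apply: IH => m; rewrite lerD ?ler_wpM2l//.
by apply: ler_sum => i _; rewrite ler_wpM2l.
Qed.

Lemma sexpD n g h : sexp n (fun m => g m + h m) = sexp n g + sexp n h.
Proof.
elim: n g h => [|n IH] g h //=; rewrite -mulrDr; congr (_ * _).
rewrite addrACA -IH; congr (_ + _); apply: eq_sexp => m _.
rewrite addrACA -mulrDr -big_split; congr (_ + _).
by apply: eq_bigr => i _; rewrite mulrDr.
Qed.

Lemma sexpZ n c g : sexp n (fun m => c * g m) = c * sexp n g.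
Proof.
elim: n g => [|n IH] g //=; rewrite [RHS]mulrCA [in RHS]mulrDr -IH; congr (_ * (_ + _)).
apply: eq_sexp => m _; rewrite mulrDr mulr_sumr mulrCA; congr (_ + _).
by apply: eq_bigr => i _; rewrite mulrCA.
Qed.

Lemma sexp0 n : sexp n (fun=> 0) = 0.
Proof.
by have := sexpZ n 0 (fun=> 0); under eq_sexp do rewrite mul0r; rewrite mul0r.
Qed.

Lemma sexp_sum n (I : Type) (r : seq I) (g : I -> K.-tuple nat -> R) :
  sexp n (fun m => \sum_(i <- r) g i m) = \sum_(i <- r) sexp n (g i).
Proof.
elim: r => [|i r IH].
  by rewrite big_nil -[RHS](sexp0 n); apply: eq_sexp => m _; rewrite big_nil.
by rewrite big_cons -IH -sexpD; apply: eq_sexp => m _; rewrite big_cons.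
Qed.

(** Independence of the subtrees is expressed through products of functionals,
    one for each subtree. *)
Definition child_prod F (G : 'I_K -> ptree -> R) (t : ptree) : R :=
  F (child t 0) * \prod_(i < K) G i (child t i.+1).

(** The three terms are growth at the phantom edge, growth in the first subtree
    and growth in another subtree. *)
Lemma sum_grow_child_prod F (G : 'I_K -> ptree -> R) (t : ptree) :
  finite_set [set u | vertex t u] -> t [::] = k ->
  sum_grow (child_prod F G) t =
  F t * \prod_(i < K) G i leaf +
  (child_prod (sum_grow F) G t +
  \sum_(i < K)
    child_prod F (fun j => if j == i then sum_grow (G j) else G j) t).
Proof.
move=> tfin tk; rewrite /sum_grow big_vertices//; congr (_ + _).
rewrite tk big_ord_recl/=; congr (_ + _).
  rewrite /child_prod mulr_suml; apply: eq_bigr => w _.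
  by congr (_ * _).
apply: eq_bigr => i _; rewrite /child_prod (bigD1 i)//= eqxx.
rewrite mulr_suml mulr_sumr; apply: eq_bigr => w _; congr (_ * _).
rewrite (bigD1 i)//=; congr (_ * _).
  by congr (G i _); rewrite /child /= /bump leq0n add1n eqxx.
apply: eq_bigr => j ji; rewrite (negbTE ji); congr (G j _).
by rewrite /child /= /bump leq0n add1n ifN.
Qed.

(** Given the sizes of the subtrees of the root, these subtrees are independent
    grown trees: both the creation of a new root and the growth of one subtree
    preserve this property. *)
Lemma gexp_child_prod n F (G : 'I_K -> ptree -> R) :
  gexp n.+1 (child_prod F G) =
  sexp n (fun m => gexp (n - total_size m) F * \prod_(i < K) gexp (tnth m i) (G i)).
Proof.
elim: n F G => [|n IH] F G.
  have := gexp_sum_grow 0 (child_prod F G); rewrite muln0 mul1r gexp0 => <-.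
  have lv := vertices_perm finite_vertex_leaf.
  rewrite /sum_grow (perm_big _ lv) big_seq1 /= total_zero gexp0.
  by congr (_ * _); apply: eq_bigr => i _; rewrite tnth_mktuple gexp0.
have pos : (k * n.+1 + 1)%:R != 0 :> R by rewrite pnatr_eq0 addn1.
apply: (mulfI pos); rewrite -gexp_sum_grow.
rewrite (@eq_gexp _ _ (fun t => F t * \prod_(i < K) G i leaf +
  (child_prod (sum_grow F) G t +
  \sum_(i < K)
    child_prod F (fun j => if j == i then sum_grow (G j) else G j) t))); last first.
  move=> p pn; rewrite sum_grow_child_prod//; first exact: growth_finite pn.
  exact: growth_root pn.
rewrite !gexpD gexp_sum IH /= mulVKf//; congr (_ + _).
  rewrite (@eq_gexp _ _ (fun t => \prod_(i < K) G i leaf * F t)); last first.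
    by move=> p _; rewrite mulrC.
  rewrite gexpZ mulrC total_zero subn0; congr (_ * _).
  by apply: eq_bigr => i _; rewrite tnth_mktuple gexp0.
under [X in _ + X]eq_bigr do rewrite IH.
rewrite -sexp_sum -sexpD; apply: eq_sexp => m mn; congr (_ + _).
  by rewrite gexp_sum_grow mulrA subSn.
apply: eq_bigr => i _; rewrite total_incr subSS mulrCA; congr (_ * _).
rewrite (bigD1 i)//= eqxx gexp_sum_grow -mulrA; congr (_ * _).
rewrite [RHS](bigD1 i)//= tnth_mktuple eqxx addn1; congr (_ * _).
by apply: eq_bigr => j /negbTE ji; rewrite ji tnth_mktuple ji addn0.
Qed.

End growth_expectation.

(** * The Gamma function *)

Section Gamma_function.
Variable R : realType.
Local Notation mu := (@lebesgue_measure R).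
Local Notation J n := `[(n.+2%:R : R)^-1, n.+2%:R]%classic.

Lemma continuous_powR_gt0 (a x : R) : 0 < x -> {for x, continuous (@powR R ^~ a)}.
Proof.
move=> x0; apply: differentiable_continuous; apply/derivable1_diffP.
by apply: derivable_powR; rewrite in_itv/= x0.
Qed.

(** One term of the exponential series beats the power, with [1 / x] to spare. *)
Lemma powR_expRN_le (a x : R) (M : nat) : a <= M%:R -> 1 <= x ->
  x `^ a * expR (- x) <= M.+1`!%:R / x.
Proof.
move=> aM x1; have x0 : 0 < x by apply: lt_le_trans x1.
apply: (@le_trans _ _ (x `^ M%:R * expR (- x))).
  by rewrite ler_wpM2r ?expR_ge0// ler_powR.
rewrite powR_mulrn ?(ltW x0)// expRN ler_pdivrMr ?expR_gt0//.
rewrite mulrAC ler_pdivlMr//.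
have f0 : 0 < (M.+1`!%:R : R) by rewrite ltr0n fact_gt0.
have h := expR_ge1Dxn M (ltW x0).
apply: (@le_trans _ _ (M.+1`!%:R * (x ^+ M.+1 / M.+1`!%:R))).
  by rewrite mulrCA divff ?gt_eqF// mulr1 -exprSr.
by rewrite ler_wpM2l ?(ltW f0)//; apply: le_trans h; rewrite lerDr ler01.
Qed.

Lemma powR_expRN_cvg0 (a : R) :
  (n.+2%:R : R) `^ a * expR (- n.+2%:R) @[n --> \oo] --> 0.
Proof.
have [M aM] : exists M : nat, a <= M%:R.
  by exists (Num.truncn a).+1; rewrite ltW// truncnS_gt.
apply: (@squeeze_cvgr _ _ _ _ (cst 0) (fun n => M.+1`!%:R * n.+2%:R^-1)).
- near=> n; rewrite mulr_ge0 ?powR_ge0 ?expR_ge0//=.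
  by apply: powR_expRN_le => //; rewrite ler1n.
- exact: cvg_cst.
- rewrite -[X in _ --> X](mulr0 (M.+1`!%:R : R)); apply: cvgMr.
  have := @cvg_harmonic R; rewrite -(cvg_shiftS (@harmonic R)).
  by [].
Unshelve. end_near. Qed.

Lemma cvg_invSS : (n.+2%:R : R)^-1 @[n --> \oo] --> 0.
Proof. by have := @cvg_harmonic R; rewrite -(cvg_shiftS (@harmonic R)). Qed.

Lemma powR_inv_cvg0 (a : R) : 0 < a ->
  ((n.+2%:R : R)^-1 `^ a) * expR (- (n.+2%:R)^-1) @[n --> \oo] --> 0.
Proof.
move=> a0.
apply: (@squeeze_cvgr _ _ _ _ (cst 0) (fun n => (n.+2%:R : R)^-1 `^ a)).
- near=> n; rewrite mulr_ge0 ?powR_ge0 ?expR_ge0//=.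
  by rewrite ler_piMr ?powR_ge0// expR_le1 oppr_le0 invr_ge0.
- exact: cvg_cst.
- have /cvg_at_rightP := powR_cvg0 a0; apply; split=> [n|]; first by rewrite invr_gt0.
  exact: cvg_invSS.
Unshelve. end_near. Qed.

Lemma bigcup_J : \bigcup_n J n = `]0, +oo[%classic.
Proof.
apply/seteqP; split=> x /=.
  move=> [n _]/=; rewrite !in_itv/= andbT => /andP[+ _]; apply: lt_le_trans.
  by rewrite invr_gt0.
rewrite in_itv/= andbT => x0; exists (Num.truncn x + Num.truncn x^-1)%N => //=.
rewrite in_itv/= invf_ple ?posrE//; apply/andP; split.
  apply: ltW; apply: lt_le_trans (truncnS_gt x^-1) _.
  by rewrite ler_nat ltnS leqW// leq_addl.
apply: ltW; apply: lt_le_trans (truncnS_gt x) _.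
by rewrite ler_nat ltnS leqW// leq_addr.
Qed.

Lemma measurable_powR_expRN (a : R) (D : set R) : measurable D ->
  measurable_fun D (fun x : R => (x `^ a * expR (- x))%:E).
Proof.
move=> mD; apply/measurable_EFinP; apply: (measurable_funS measurableT) => //.
apply: measurable_funM; first exact: measurable_powR.
by apply: (measurableT_comp (@measurable_expR R)); apply: measurable_funN.
Qed.

Lemma cvg_integral_J (a : R) :
  (\int[mu]_(x in J n) (x `^ a * expR (- x))%:E @[n --> \oo] -->
   \int[mu]_(x in `]0%R, +oo[) (x `^ a * expR (- x))%:E)%E.
Proof.
rewrite -bigcup_J; apply: ge0_nondecreasing_set_cvg_integral.
- apply/nondecreasing_seqP => n; apply/subsetPset => x /=.
  rewrite !in_itv/= => /andP[h1 h2]; apply/andP; split.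
    by apply: le_trans h1; rewrite lef_pV2 ?posrE// ler_nat.
  by apply: (le_trans h2); rewrite ler_nat.
- by [].
- by move=> n; exact: measurable_powR_expRN.
- by move=> n x _; rewrite lee_fin mulr_ge0 ?powR_ge0 ?expR_ge0.
Qed.

Lemma continuous_within_pos (f : R -> R) (n : nat) :
  (forall x : R, 0 < x -> {for x, continuous f}) ->
  {within J n, continuous f}.
Proof.
move=> cf; apply: continuous_in_subspaceT => x; rewrite inE/= in_itv/=.
by move=> /andP[h _]; apply: cf; apply: lt_le_trans h; rewrite invr_gt0.
Qed.

Lemma derivable_LR_pos (f : R -> R) (n : nat) :
  (forall x : R, 0 < x -> derivable f x 1) ->
  derivable_oo_LRcontinuous f (n.+2%:R)^-1 n.+2%:R.
Proof.
move=> df; have cf x : 0 < x -> {for x, continuous f}.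
  move=> x0; apply: differentiable_continuous; apply/derivable1_diffP.
  exact: df.
split.
- move=> x; rewrite in_itv/= => /andP[h _]; apply: df.
  by apply: lt_trans h; rewrite invr_gt0.
- by apply: cvg_at_right_filter; apply: cf; rewrite invr_gt0.
- by apply: cvg_at_left_filter; apply: cf; rewrite ltr0n.
Qed.

Lemma parts_J (a : R) (n : nat) : 0 < a ->
  (\int[mu]_(x in J n) (x `^ a * expR (- x))%:E =
   ((n.+2%:R)^-1 `^ a * expR (- (n.+2%:R)^-1)
      - n.+2%:R `^ a * expR (- n.+2%:R))%:E +
   a%:E * \int[mu]_(x in J n) (x `^ (a - 1) * expR (- x))%:E)%E.
Proof.
move=> a0.
have dG (x : R) : is_derive x 1 (fun y : R => - expR (- y)) (expR (- x)).
  by apply: is_derive_eq; rewrite mulrN1 opprK.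
have cG (x : R) : {for x, continuous (fun y : R => expR (- y))}.
  apply: continuous_comp; first exact: opp_continuous.
  exact: continuous_expR.
have pos_in (x : R) : x \in `](n.+2%:R)^-1, n.+2%:R[ -> 0 < x.
  by rewrite in_itv/= => /andP[h _]; apply: lt_trans h; rewrite invr_gt0.
have := @integration_by_parts R (fun x => x `^ a) (fun x => - expR (- x))
  (fun x => a * x `^ (a - 1)) (fun x => expR (- x)) (n.+2%:R)^-1 n.+2%:R.
move=> ->.
- rewrite -ge0_integralZl//=; first last.
  + by rewrite lee_fin ltW.
  + by move=> x _; rewrite lee_fin mulr_ge0 ?powR_ge0 ?expR_ge0.
  + exact: measurable_powR_expRN.
  under eq_integral => x _ do rewrite mulrN EFinN.
  rewrite integral_ge0N ?oppeK; last first.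
    by move=> x _; rewrite lee_fin !mulr_ge0 ?powR_ge0 ?expR_ge0 ?ltW.
  rewrite !mulrN opprK [in LHS](addrC (- _)%R); congr (_ + _)%E.
  by apply: eq_integral => x _; rewrite -EFinM mulrA.
- by rewrite (@lt_le_trans _ _ 1)// ?ler1n// invf_lt1 ?ltr1n.
- apply: continuous_within_pos => x x0; apply: cvgM; first exact: cvg_cst.
  exact: continuous_powR_gt0.
- by apply: derivable_LR_pos => x x0; apply: derivable_powR; rewrite in_itv/= x0.
- by move=> x /pos_in x0; apply: powR_derive1; rewrite in_itv/= x0.
- by apply: continuous_within_pos => x x0; exact: cG.
- by apply: derivable_LR_pos => x _; apply: ex_derive.
- by move=> x _; rewrite derive1E; apply: derive_val.
Qed.

(** Integration by parts on the segments [J n], on which everything is smooth.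
    Both integrals may be infinite here: they are limits of monotone sequences
    and the boundary terms vanish. *)
Lemma integral_parts (a : R) : 0 < a ->
  (\int[mu]_(x in `]0%R, +oo[) (x `^ a * expR (- x))%:E =
   a%:E * \int[mu]_(x in `]0%R, +oo[) (x `^ (a - 1) * expR (- x))%:E)%E.
Proof.
move=> a0; rewrite -[LHS](cvg_lim (@ereal_hausdorff R) (@cvg_integral_J a)).
apply/cvg_lim => //; under eq_fun do rewrite parts_J//.
rewrite -(add0e (a%:E * _)%E); apply: cvgeD.
- by rewrite fin_num_adde_defr.
- apply: cvg_EFin; first by near=> n.
  rewrite -[X in _ --> X](subr0 0); apply: cvgB; first exact: powR_inv_cvg0.
  exact: powR_expRN_cvg0.
- by apply: cvgeZl => //; exact: cvg_integral_J.
Unshelve. end_near. Qed.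

Lemma GammaS (a : R) : 0 < a -> Gamma (a + 1) = a * Gamma a.
Proof.
move=> a0; rewrite /Gamma /Rintegral addrK integral_parts//.
case: (\int[_]_(x in _) _)%E => [r||] //=.
  by rewrite gt0_muley ?lte_fin//= mulr0.
by rewrite gt0_muleNy ?lte_fin//= mulr0.
Qed.

(** [Gamma] is [fine] of an extended integral, so positivity includes finiteness.
    The singularity at 0 is removed by [integral_parts], and the
    remaining integrand is dominated by an exponential density. *)
Lemma Gamma_gt0 (a : R) : 0 < a -> a <= 1 -> 0 < Gamma a.
Proof.
move=> a0 a1; rewrite /Gamma /Rintegral; apply: fine_gt0; apply/andP; split.
- have mD : measurable (`]0, 1] : set R) by [].
  have h : (\int[mu]_(x in `]0%R, 1%R]) (expR (-1 : R))%:E <=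
            \int[mu]_(x in `]0%R, +oo[) (x `^ (a - 1) * expR (- x))%:E)%E.
    apply: (@le_trans _ _
        (\int[mu]_(x in `]0%R, 1%R]) (x `^ (a - 1) * expR (- x))%:E)%E).
      apply: ge0_le_integral => //=.
      + exact: measurable_powR_expRN.
      + move=> x; rewrite in_itv/= => /andP[x0 x1]; rewrite lee_fin.
        rewrite -[leLHS]mul1r ler_pM ?expR_ge0// ?ler_expR ?lerN2//.
        rewrite -[leLHS](powRr0 x); apply: ger_powR; first by rewrite x0.
        by rewrite subr_le0.
    apply: ge0_subset_integral => //=.
    + exact: measurable_powR_expRN.
    + by move=> x _; rewrite lee_fin mulr_ge0 ?powR_ge0 ?expR_ge0.
    + by move=> x /=; rewrite !in_itv/= andbT => /andP[].
  apply: lt_le_trans h; rewrite integral_cst//= lebesgue_measure_itv/= lte01.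
  by rewrite oppr0 adde0 mule1 lte_fin expR_gt0.
- have ya : (\int[mu]_(x in `]0%R, +oo[) (x `^ a * expR (- x))%:E < +oo)%E.
    apply: (@le_lt_trans _ _
      ((4%:E * \int[mu]_x (exponential_pdf (2^-1 : R) x)%:E)%E)); last first.
      by rewrite integral_exponential_pdf ?invr_gt0// mule1 ltry.
    have me := measurable_exponential_pdf (2^-1 : R).
    rewrite -ge0_integralZl//=; first last.
    + by move=> x _; rewrite lee_fin exponential_pdf_ge0 ?invr_ge0.
    + exact/measurable_EFinP.
    apply: (@le_trans _ _
      (\int[mu]_(x in `]0%R, +oo[) (4%:E * (exponential_pdf (2^-1 : R) x)%:E))%E).
      apply: ge0_le_integral => //=.
      + by move=> x _; rewrite lee_fin mulr_ge0 ?powR_ge0 ?expR_ge0.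
      + exact: measurable_powR_expRN.
      + apply/measurable_EFinP; apply: measurable_funM => //.
        exact: measurable_funTS.
      + move=> x; rewrite in_itv/= andbT => x0; rewrite -EFinM lee_fin.
        rewrite exponential_pdfE ?(ltW x0)// mulrA.
        have xa : x `^ a <= 2 * expR (2^-1 * x).
          apply: (@le_trans _ _ (1 + x)).
            case: (leP x 1) => x1.
              apply: (@le_trans _ _ 1); last by rewrite lerDl ltW.
              rewrite -[leRHS](powRr0 x); apply: ger_powR; last exact: ltW.
              by rewrite x0.
            by rewrite (@le_trans _ _ x) ?lerDr// ler1_powR// ltW.
          have := expR_ge1Dx (2^-1 * x); lra.
        have -> : expR (- x) = expR (- (2^-1 * x)) * expR (- (2^-1 * x)).
          by rewrite -expRD; congr expR; lra.
        have ex0 := expR_gt0 (- (2^-1 * x)).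
        rewrite mulNr mulrA ler_pM2r// (_ : 4 * 2^-1 = 2); last by lra.
        by rewrite expRN ler_pdivrMr ?expR_gt0.
    apply: ge0_subset_integral => //=.
    + apply/measurable_EFinP; apply: measurable_funM => //.
    + by move=> x _; rewrite -EFinM lee_fin mulr_ge0// exponential_pdf_ge0 ?invr_ge0.
  move: ya; rewrite integral_parts//; case: (\int[_]_(x in _) _)%E => //= [r _|].
    by rewrite ltry.
  by rewrite gt0_muley ?lte_fin.
Qed.

End Gamma_function.

(** * Lower limits and the law of the sizes *)

Section lower_limits.
Variable R : realType.
Implicit Types (a b x : nat -> R) (L M c e : R).

(** This is [L <= liminf a]. *)
Definition lowlim a L : Prop :=
  forall e, 0 < e -> exists N, forall n, (N <= n)%N -> L - e <= a n.

Lemma lowlim_ge a L : (forall n, L <= a n) -> lowlim a L.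
Proof.
move=> aL e e0; exists 0%N => n _; apply: le_trans (aL n).
by rewrite gerBl ltW.
Qed.

Lemma lowlim_le a b L M : M <= L -> (forall n, a n <= b n) ->
  lowlim a L -> lowlim b M.
Proof.
move=> ML ab aL e /aL[N NP]; exists N => n /NP h.
by apply: le_trans (ab n); apply: le_trans h; rewrite lerD2r.
Qed.

Lemma lowlimD a b L M : lowlim a L -> lowlim b M ->
  lowlim (fun n => a n + b n) (L + M).
Proof.
move=> aL bM e e0; have e20 : 0 < e / 2 by rewrite divr_gt0.
have [N NP] := aL _ e20; have [N' NP'] := bM _ e20.
exists (maxn N N') => n; rewrite geq_max => /andP[/NP h /NP' h'].
move: h h'; lra.
Qed.

Lemma lowlim_sum (I : Type) (r : seq I) (a : I -> nat -> R) (L : I -> R) :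
  (forall i, lowlim (a i) (L i)) ->
  lowlim (fun n => \sum_(i <- r) a i n) (\sum_(i <- r) L i).
Proof.
move=> aL; elim: r => [|i r IH].
  by apply: lowlim_ge => n; rewrite !big_nil.
rewrite big_cons; apply: lowlim_le (lowlimD (aL i) IH) => // n.
by rewrite big_cons.
Qed.

Lemma lowlimZ c a L : 0 <= c -> lowlim a L -> lowlim (fun n => c * a n) (c * L).
Proof.
rewrite le_eqVlt => /predU1P[<- _|c0 aL e e0].
  by apply: lowlim_ge => n; rewrite !mul0r.
have [N NP] := aL _ (divr_gt0 e0 c0); exists N => n /NP h.
have := ler_wpM2l (ltW c0) h.
by rewrite mulrBr [c * (e / c)]mulrC divfK ?gt_eqF.
Qed.

Lemma lowlim_shift a L : lowlim (fun n => a n.+1) L -> lowlim a L.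
Proof.
by move=> aL e /aL[N NP]; exists N.+1 => -[//|n] /NP.
Qed.

Lemma lowlim_subn j a L : lowlim a L -> lowlim (fun n => a (n - j)%N) L.
Proof.
move=> aL e /aL[N NP]; exists (N + j)%N => n Nn; apply: NP; lia.
Qed.

(** The deficit [y] of [x] below [B / c - e / 2] satisfies
    (n + d) y (n+1) <= (n + d - c) y n, and [1 <= c], so (n + d - 1) y n stays
    bounded and [y] is eventually small. *)
Lemma lowlim_rec x b B c d (N0 : nat) : 1 <= c -> 1 <= d -> lowlim b B ->
  (forall n, (N0 <= n)%N ->
    (n%:R + d - c) * x n + b n <= (n%:R + d) * x n.+1) ->
  lowlim x (B / c).
Proof.
move=> c1 d1 bB xrec e e0; have c0 : 0 < c by apply: lt_le_trans c1.
have [N1 N1P] := bB (c * (e / 2)) (mulr_gt0 c0 (divr_gt0 e0 (ltr0n _ 2))).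
pose y n := B / c - e / 2 - x n.
pose N2 := (maxn N0 (maxn N1 (Num.truncn c).+1)).
have yrec n : (N2 <= n)%N ->
    0 <= n%:R + d - c /\ (n%:R + d) * y n.+1 <= (n%:R + d - c) * y n.
  rewrite !geq_max => /and3P[/xrec hx /N1P hb cn]; split.
    have := lt_le_trans (truncnS_gt c) (_ : _ <= n%:R).
    by rewrite ler_nat => /(_ cn); move: d1; lra.
  rewrite /y; have Bc : B = c * (B / c) by rewrite mulrC divfK ?gt_eqF.
  move: hx hb; rewrite {1}Bc; set t := B / c; nra.
pose C := Num.max 0 ((N2%:R + d - 1) * y N2).
have yC n : (N2 <= n)%N -> (n%:R + d - 1) * y n <= C.
  elim: n => [|n IH].
    by rewrite leqn0 => /eqP N20; rewrite /C N20 le_max lexx orbT.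
  rewrite leq_eqVlt => /predU1P[<-|N2n]; first by rewrite le_max lexx orbT.
  have C0 : 0 <= C by rewrite le_max lexx.
  have := IH N2n; have [] := yrec n N2n; rewrite -natr1.
  case: (leP (y n) 0) => yn; nra.
exists (maxn N2 (Num.truncn (C / (e / 2))).+1) => n; rewrite geq_max => /andP[N2n Cn].
have Cn' : C / (e / 2) < n%:R.
  by apply: lt_le_trans (truncnS_gt _) _; rewrite ler_nat.
have n0 : 0 < (n%:R : R) by rewrite ltr0n (leq_trans _ Cn).
move: Cn'; rewrite ltr_pdivrMr ?divr_gt0// => Cn'.
have := yC n N2n; suff : y n <= e / 2 by rewrite /y; lra.
case: (leP (y n) (e / 2)) => // ye; move: (yC n N2n); nra.
Qed.

End lower_limits.

Section size_law.
Variables (R : realType) (K : nat).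
Local Notation k := K.+1.
Implicit Types (n : nat) (m : K.-tuple nat).

(** The factors of the negative Dirichlet multinomial weights; they are the
    coefficients of the power series of (1 - x)^(-1/k). *)
Definition gamma_coef (j : nat) : R :=
  Gamma (j%:R + k%:R^-1) / (Gamma k%:R^-1 * j`!%:R).

Let kinv_gt0 : 0 < k%:R^-1 :> R. Proof. by rewrite invr_gt0. Qed.

Lemma gamma_coef0 : gamma_coef 0 = 1.
Proof.
rewrite /gamma_coef add0r fact0 mulr1 divff// gt_eqF// Gamma_gt0//.
by rewrite invf_le1// ler1n.
Qed.

(** The functional equation of the Gamma function, free of denominators. *)
Lemma gamma_coefS j :
  k%:R * j.+1%:R * gamma_coef j.+1 = (k * j + 1)%:R * gamma_coef j.
Proof.
have k0 : (k%:R : R) != 0 by rewrite pnatr_eq0.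
have f0 : (j`!%:R : R) != 0 by rewrite pnatr_eq0 -lt0n fact_gt0.
have j0 : (j.+1%:R : R) != 0 by rewrite pnatr_eq0.
have G0 : Gamma (k%:R^-1 : R) != 0.
  by rewrite gt_eqF// Gamma_gt0// invf_le1// ler1n.
rewrite /gamma_coef.
have -> : j.+1%:R + k%:R^-1 = j%:R + k%:R^-1 + 1 :> R by rewrite -natr1 addrAC.
rewrite GammaS; last by rewrite ltr_wpDl.
rewrite factS natrD !natrM; field.
by rewrite G0 f0 !nat1r k0 j0.
Qed.

Lemma neg_dirichletE m : neg_dirichlet_multinomial R (m : k.-1.-tuple nat) =
  k%:R^-1 * (1 + (total_size m)%:R)^-1 * \prod_(i < K) gamma_coef (tnth m i).
Proof. by []. Qed.

(** The recurrence [sexp_indic_rec] for a sequence that does not depend on [n].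
    Lowering [m_i] by one multiplies the product of the [gamma_coef] by
    k m_i / (k (m_i - 1) + 1), so the sum on the right collapses to the sum of
    the [m_i]. *)
Lemma neg_dirichlet_rec m :
  k%:R * (1 + (total_size m)%:R) * neg_dirichlet_multinomial R (m : k.-1.-tuple nat) =
  (zero_sizes K == m)%:R + \sum_(i < K) (0 < tnth m i)%:R *
    ((k * (tnth m i).-1 + 1)%:R *
     neg_dirichlet_multinomial R (decr_size m i : k.-1.-tuple nat)).
Proof.
have k0 : (k%:R : R) != 0 by rewrite pnatr_eq0.
have t0 : (1 + (total_size m)%:R : R) != 0 by rewrite gt_eqF// ltr_wpDr.
rewrite neg_dirichletE mulrA [_ * (k%:R^-1 * _)](_ : _ = 1) ?mul1r; last first.
  by field; rewrite !nat1r !pnatr_eq0.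
case: eqVneq => [<-|m0].
  by rewrite !big1 ?addr0// => i _; rewrite tnth_mktuple ?gamma_coef0 ?mul0r.
have tm0 : (0 < total_size m)%N.
  rewrite lt0n; apply: contraNneq m0 => tm; apply/eqP/eq_from_tnth => i.
  rewrite tnth_mktuple; apply/esym/eqP.
  by move/eqP: tm; rewrite sum_nat_eq0 => /forallP/(_ i).
rewrite add0r.
have tmR : (total_size m)%:R != 0 :> R by rewrite pnatr_eq0 -lt0n.
transitivity (\sum_(i < K) (tnth m i)%:R * ((total_size m)%:R^-1 *
    \prod_(j < K) gamma_coef (tnth m j))).
  by rewrite -mulr_suml -natr_sum mulrA divff// mul1r.
apply: eq_bigr => i _; case: (posnP (tnth m i)) => [->|mi]; first by rewrite !mul0r.
have td : total_size m = (total_size (decr_size m i)).+1.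
  by rewrite -(total_incr _ i) decrK.
rewrite mul1r neg_dirichletE nat1r -td.
rewrite (bigD1 i)//= [in RHS](bigD1 i)//= tnth_mktuple eqxx subn1.
rewrite (eq_bigr (fun j => gamma_coef (tnth (decr_size m i) j))); last first.
  by move=> j /negbTE ji; rewrite tnth_mktuple ji subn0.
set P := \prod_(j < K | _) _.
have := gamma_coefS (tnth m i).-1; rewrite prednK// => gS.
transitivity (k%:R^-1 * (total_size m)%:R^-1 *
  (k%:R * (tnth m i)%:R * gamma_coef (tnth m i)) * P).
  by field; rewrite nat1r tmR pnatr_eq0.
by rewrite gS; ring.
Qed.

Definition at_size m : K.-tuple nat -> R := fun m' => (m' == m)%:R.

Lemma sexp_indic_rec n m :
  (k * n.+1 + 1)%:R * sexp n.+1 (at_size m) =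
  (zero_sizes K == m)%:R +
  ((k * (n - total_size m) + 1)%:R * sexp n (at_size m) +
   \sum_(i < K) (0 < tnth m i)%:R * ((k * (tnth m i).-1 + 1)%:R *
     sexp n (at_size (decr_size m i)))).
Proof.
have pos : (k * n.+1 + 1)%:R != 0 :> R by rewrite pnatr_eq0 addn1.
rewrite /= mulVKf//; congr (_ + _).
rewrite sexpD sexp_sum; congr (_ + _).
  rewrite -sexpZ; apply: eq_sexp => m' _; rewrite /at_size.
  by case: eqVneq => [->//|]; rewrite !mulr0.
apply: eq_bigr => i _; rewrite -2!sexpZ; apply: eq_sexp => m' _; rewrite /at_size.
case: (posnP (tnth m i)) => [mi|mi].
  rewrite mul0r [_ == m]negbTE ?mulr0//.
  by apply: contra_eqN mi => /eqP <-; rewrite -lt0n incr_gt0.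
rewrite mul1r; case: (eqVneq m' (decr_size m i)) => [->|m'm].
  rewrite decrK// eqxx /=; congr (_ * _); congr ((k * _ + 1)%:R).
  by rewrite tnth_mktuple eqxx subn1.
rewrite [_ == m]negbTE ?mulr0//; apply: contra_neqN m'm => /eqP <-.
by rewrite incrK.
Qed.

(** By induction on the total size, since [sexp_indic_rec] feeds the limits at
    the vectors [decr_size m i] into [lowlim_rec]. *)
Lemma lowlim_sexp m : lowlim (fun n => sexp n (at_size m))
  (neg_dirichlet_multinomial R (m : k.-1.-tuple nat)).
Proof.
have k0 : (k%:R : R) != 0 by rewrite pnatr_eq0.
have [s] := ubnP (total_size m); elim: s m => // s IH m ms.
have t0 : (1 + (total_size m)%:R : R) != 0 by rewrite gt_eqF// ltr_wpDr.
pose B (f : K.-tuple nat -> R) := k%:R^-1 * ((zero_sizes K == m)%:R +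
  \sum_(i < K) (0 < tnth m i)%:R * ((k * (tnth m i).-1 + 1)%:R * f (decr_size m i))).
rewrite (_ : neg_dirichlet_multinomial R _ =
    B (fun m' => neg_dirichlet_multinomial R (m' : k.-1.-tuple nat)) /
    (1 + (total_size m)%:R)); last first.
  by rewrite /B -neg_dirichlet_rec; field; rewrite !nat1r !pnatr_eq0.
(* The recurrence is divided by [k], hence [d = 1 + 1/k]. *)
apply: (@lowlim_rec _ _ (fun n => B (fun m0 => sexp n (at_size m0)))
  _ _ (1 + k%:R^-1) (total_size m)).
- by rewrite lerDl.
- by rewrite lerDl ltW.
- apply: lowlimZ; first exact: ltW.
  apply: lowlimD; first by apply: lowlim_ge => n; exact: lexx.
  apply: lowlim_sum => i; case: (posnP (tnth m i)) => mi.
    by apply: lowlim_ge => n; rewrite !mul0r.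
  do 2 (apply: lowlimZ; first by []).
  by apply: IH; rewrite -ltnS (leq_trans _ ms)// -(decrK mi) total_incr decrK.
- move=> n tn; rewrite /B -(ler_pM2l (ltr0Sn R K)).
  rewrite le_eqVlt; apply/orP; left; apply/eqP.
  have := sexp_indic_rec n m.
  set x1 := sexp n.+1 _; set x0 := sexp n (at_size m).
  set S := \sum_(i < K) _ => e.
  transitivity ((k * n.+1 + 1)%:R * x1); last first.
    by rewrite natrD natrM -natr1; field.
  rewrite e !natrD natrM natrB//; field.
  by rewrite nat1r pnatr_eq0.
Qed.

End size_law.

(** * The local topology and countable unions *)

Section cylinders.
Variable R : realType.
Implicit Types (r i : nat) (x y : loctree R).

(** The trees with a given ball at the root; empty if [i] is not a code. *)
Definition cyl r i : set (loctree R) := [set x | ball_code r x = i].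

Lemma EFin_dloc x y : ((dloc R x y)%:E = expeR (- ereal_inf
  [set (r%:R : R)%:E | r in [set r : nat | restr r x <> restr r y]]))%E.
Proof.
rewrite fineK// ge0_fin_numE ?expeR_ge0//; apply: (@le_lt_trans _ _ 1%:E%E).
  rewrite -expeR0 lee_expeR leeNl oppe0.
  by apply: le_ereal_inf_tmp => _ [r _ <-]; rewrite lee_fin.
by rewrite ltry.
Qed.

Lemma dloc_le r x y : restr r x = restr r y -> dloc R x y <= expR (- r%:R).
Proof.
move=> xy; rewrite -lee_fin EFin_dloc.
rewrite -[(expR _)%:E]/(expeR (- r%:R%:E)) lee_expeR leeN2.
apply: le_ereal_inf_tmp => _ [r' /= xy' <-]; rewrite lee_fin ler_nat leqNgt.
by apply/negP => /ltnW r'r; apply: xy'; exact: restr_nested xy.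
Qed.

Lemma restr_dloc r x y : dloc R x y < expR (- r%:R) -> restr r x = restr r y.
Proof.
apply: contraPP => xy; apply/negP; rewrite -leNgt -lee_fin EFin_dloc.
rewrite -[(expR _)%:E]/(expeR (- r%:R%:E)) lee_expeR leeN2.
by apply: ereal_inf_lbound; exists r.
Qed.

Lemma open_cyl r i : open (cyl r i).
Proof.
rewrite openE => x /= xi; apply/nbhs_ballP; exists (expR (- r%:R)) => /=.
  exact: expR_gt0.
by move=> y /restr_dloc/codeP xy; rewrite /cyl /= -xy.
Qed.

Lemma nbhs_cyl x (U : set (loctree R)) : nbhs x U ->
  exists r, cyl r (ball_code r x) `<=` U.
Proof.
move=> /nbhs_ballP[e /= e0 eU]; exists (Num.truncn e^-1).+1 => y /= /codeP yx.
apply: eU; apply: (@le_lt_trans _ _ (expR (- (Num.truncn e^-1).+1%:R))).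
  exact: dloc_le.
have h := truncnS_gt e^-1; set N := (Num.truncn _).+1 in h *.
have N0 : 0 < N%:R :> R by rewrite ltr0n.
rewrite expRN invf_plt ?posrE ?expR_gt0//; apply: lt_trans h _.
by apply: lt_le_trans (expR_ge1Dx _); rewrite ltrDr.
Qed.

Lemma measurable_cyl r i : measurable (cyl r i : set (borel (loctree R))).
Proof. by apply: sub_sigma_algebra; exact: open_cyl. Qed.

End cylinders.

Section discrete_sums.
Variable R : realType.

(** Fatou for countable disjoint unions: all but [e / 2] of the mass of the union
    is carried by finitely many pieces, and only these have to be bounded. *)
Lemma lowlim_bigcup d (Om : measurableType d) (P : probability Om R)
    (I : countType) (D : I -> set Om) (a : nat -> R) (b : I -> nat -> R) :
  (forall i, measurable (D i)) -> trivIset [set: I] D ->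
  (forall n (F : seq I), uniq F -> \sum_(i <- F) b i n <= a n) ->
  (forall i, lowlim (b i) (fine (P (D i)))) ->
  lowlim a (fine (P (\bigcup_i D i))).
Proof.
move=> mD tD ba bD e e0; have e20 : 0 < e / 2 by rewrite divr_gt0.
pose D' (j : nat) := oapp D set0 (@pickle_inv I j).
have mD' j : measurable (D' j) by rewrite /D'; case: pickle_inv => [i|] /=.
have tD' : trivIset setT D'.
  apply/trivIsetP => j j' _ _ jj'; rewrite /D'.
  case ej : (@pickle_inv I j) => [i|] /=; last by rewrite set0I.
  case ej' : (@pickle_inv I j') => [i'|] /=; last by rewrite setI0.
  move/trivIsetP : tD; apply=> //; apply: contraNneq jj' => ii'.
  have := @pickle_invK I j; have := @pickle_invK I j'.
  by rewrite ej ej' /= ii' => -> ->.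
have -> : \bigcup_i D i = \bigcup_j D' j.
  apply/seteqP; split=> [w [i _ Diw]|w [j _]].
    by exists (pickle i) => //; rewrite /D' pickleK_inv.
  by rewrite /D'; case: pickle_inv => //= i Diw; exists i.
have cvgP : ((fun n => \sum_(0 <= j < n) P (D' j)) n @[n --> \oo] -->
    P (\bigcup_j D' j))%E.
  exact: measure_sigma_additive.
move: cvgP.
rewrite -[X in _ --> X](fineK (fin_num_measure P _ (bigcupT_measurable D' mD'))).
move=> /fine_cvgP [_ /cvgrPdist_lt /(_ _ e20)[N _ /(_ N (leqnn N))]] /=.
pose F := pmap (@pickle_inv I) (iota 0 N).
have -> : fine (\sum_(0 <= j < N) P (D' j)) = \sum_(i <- F) fine (P (D i)).
  rewrite -sum_fine; last by move=> j _; exact: fin_num_measure.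
  rewrite /F /index_iota subn0; elim: (iota 0 N) => [|j s IH].
    by rewrite !big_nil.
  rewrite big_cons IH /= /D'; case: pickle_inv => [i|] /=.
    by rewrite big_cons.
  by rewrite measure0 add0r.
move=> h; have uF : uniq F.
  by apply: (pmap_uniq (@pickle_invK I)); exact: iota_uniq.
have [M MP] := lowlim_sum F bD e20.
exists M => n /MP hn; have := ba n F uF; move: h hn.
rewrite ltr_norml => /andP[_]; lra.
Qed.

Lemma sum_indic_le (T : Type) (I : eqType) (D : I -> set T) (U : set T)
    (F : seq I) (x : T) :
  trivIset [set: I] D -> (forall i, D i `<=` U) -> uniq F ->
  \sum_(i <- F) \1_(D i) x <= \1_U x :> R.
Proof.
move=> tD DU uF; have [[i iF Dix]|nD] := pselect (exists2 i, i \in F & D i x).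
  rewrite (bigD1_seq i)//= big1 ?addr0.
    by rewrite !indicE (mem_set Dix) (mem_set (DU _ _ Dix)).
  move=> j ji; rewrite indicE memNset// => Djx; move/negP: ji; apply.
  by apply/eqP; apply: tD => //; exists x.
rewrite big_seq big1 ?indicE// => i iF; rewrite indicE memNset// => Dix.
by apply: nD; exists i.
Qed.

End discrete_sums.

(** * The balls of the limit tree *)

Lemma GT_gexp (R : realType) K n (A : set (borel (loctree R))) :
  GT K.+1 n A = (gexp K n (fun t => \1_A (tree_of t : borel (loctree R)) : R))%:E.
Proof.
rewrite /GT /msum /growth_mass /= /mscale /= /dirac /gexp.
by rewrite (big_nth (0%:nng, leaf)) big_mkord -sumEFin.
Qed.

(** The tree hanging from [v_0] is built from the tree hanging from [v_1] just as
    a grown tree is built from its first subtree. *)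
Lemma spine_treeE k (s : nat -> k.-1.-tuple tree) :
  spine_tree s = nodeT k (fun i =>
    if i is i'.+1 then nth (tree_of leaf) (s 0%N) i'
    else spine_tree (fun n => s n.+1)).
Proof.
rewrite /spine_tree.
set tau := (fun n i => rep (nth (tree_of leaf) (s n) i)).
have -> : spine k tau = node k (fun i => if i is i'.+1 then tau 0%N i'
    else spine k (fun n => tau n.+1)).
  by apply/funext => -[|[|i] w].
rewrite tree_of_node; apply: nodeT_ext => -[|i] _ //.
by rewrite tree_of_rep.
Qed.

(** A factor with lower limit [q] may replace [q], as [y] is bounded. *)
Lemma lowlim_mul (R : realType) (x y : nat -> R) (q c L : R) :
  0 <= c -> (forall n, 0 <= y n <= 1) -> lowlim x q ->
  lowlim (fun n => c * q * y n) L -> lowlim (fun n => c * (x n * y n)) L.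
Proof.
move=> c0 y01 xq yL e e0; have c1 : 0 < c + 1 by rewrite ltr_wpDl.
have e20 : 0 < e / 2 by rewrite divr_gt0.
have [N NP] := xq _ (divr_gt0 e20 c1); have [N' NP'] := yL _ e20.
exists (maxn N N') => n; rewrite geq_max => /andP[/NP h /NP' h'].
have /andP[y0 y1] := y01 n; set f := e / 2 / (c + 1) in h.
have fE : f * (c + 1) = e / 2 by rewrite divfK ?gt_eqF.
have f0 : 0 < f by rewrite divr_gt0.
have cy0 : 0 <= c * y n by rewrite mulr_ge0.
have h1 : c * y n * (q - f) <= c * y n * x n by rewrite ler_wpM2l.
have h2 : c * f * y n <= c * f by rewrite ler_piMr// mulr_ge0// ltW.
move: h' h1 h2 fE f0; nra.
Qed.

Lemma sexp_sum_le (R : realType) K n (F : seq (K.-tuple nat))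
    (g : K.-tuple nat -> R) : uniq F -> (forall m, 0 <= g m) ->
  \sum_(m <- F) sexp n (at_size R m) * g m <= sexp n g.
Proof.
move=> uF g0; rewrite (eq_bigr (fun m => sexp n (fun m' => g m * at_size R m m'))).
  rewrite -sexp_sum; apply: ler_sexp => m'; rewrite /at_size.
  have [mF|mF] := boolP (m' \in F).
    rewrite (bigD1_seq m')//= eqxx mulr1 big1 ?addr0// => m /negbTE mm.
    by rewrite eq_sym mm mulr0.
  rewrite big_seq big1// => m mF'; case: eqVneq => [e|]; last by rewrite mulr0.
  by rewrite e mF' in mF.
by move=> m _; rewrite sexpZ mulrC.
Qed.

Section limit_tree.
Variables (R : realType) (K : nat).
Local Notation k := K.+1.
Local Notation T := (borel (loctree R)).
Context d (Om : measurableType d) (P : probability Om R).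
Variables (X : nat -> {RV P >-> K.-tuple nat}) (tau : nat -> {RV P >-> K.-tuple T}).

(** The subtree above [v_j]. *)
Definition spine_from j (w : Om) : tree :=
  @spine_tree k (fun n => tau (j + n)%N w).

Lemma spine_fromE j w : spine_from j w = nodeT k (fun i =>
  if i is i'.+1 then nth (tree_of leaf) (tau j w) i' else spine_from j.+1 w).
Proof.
rewrite /spine_from spine_treeE addn0; apply: nodeT_ext => -[|i] // _.
by congr spine_tree; apply/funext => n; rewrite addnS addSn.
Qed.

(** The balls with codes [c] at the children make the ball with code [s] at the
    root; by [children_codeE] any trees with these balls can be the witness. *)
Definition children_code r s (c : nat * K.-tuple nat) : Prop :=
  exists x : nat -> tree, [/\ ball_code r (x 0%N) = c.1,
    forall i : 'I_K, ball_code r (x i.+1) = tnth c.2 i &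
    ball_code r.+1 (nodeT k x) = s].

Lemma children_codeE r s c (y : nat -> tree) : ball_code r (y 0%N) = c.1 ->
  (forall i : 'I_K, ball_code r (y i.+1) = tnth c.2 i) ->
  children_code r s c <-> ball_code r.+1 (nodeT k y) = s.
Proof.
move=> y0 yi; split=> [[x [x0 xi <-]]|ys]; last by exists y.
apply: code_nodeT => -[_|i ik]; first by rewrite y0 x0.
by have := yi (Ordinal (ik : (i < K)%N)); rewrite -xi.
Qed.

Definition tau_code r j (c : K.-tuple nat) : set Om :=
  [set w | forall i, ball_code r (tnth (tau j w) i) = tnth c i].

Lemma measurable_tau_code r j c : measurable (tau_code r j c).
Proof.
have -> : tau_code r j c =
    \bigcap_(i in [set: 'I_K])
      (tau j @^-1` ((fun x => tnth x i) @^-1` cyl r (tnth c i))).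
  by apply/seteqP; split=> [w h i _|w h i]; [exact: h|exact: (h i)].
apply: fin_bigcap_measurable => // i _; rewrite -[X in measurable X]setTI.
have mt : measurable ((fun x : K.-tuple T => tnth x i) @^-1` cyl r (tnth c i)).
  rewrite -[X in measurable X]setTI; apply: (measurable_tnth (T := T) i) => //.
  exact: measurable_cyl.
by have := measurable_funPT (tau j) measurableT _ mt.
Qed.

Lemma spine_code_bigcup r j s :
  [set w | ball_code r.+1 (spine_from j w) = s] =
  \bigcup_(c : nat * K.-tuple nat)
    ([set w | children_code r s c] `&`
     (tau_code r j c.2 `&` [set w | ball_code r (spine_from j.+1 w) = c.1])).
Proof.
pose y w i := if i is i'.+1 then nth (tree_of leaf) (tau j w) i'
              else spine_from j.+1 w.
have yE w i : y w (nat_of_ord i).+1 = tnth (tau j w) i.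
  by rewrite /y -tnth_nth.
apply/seteqP; split=> [w ws|w [c _ [ccs [wt wc]]]] /=.
- exists (ball_code r (spine_from j.+1 w),
    [tuple ball_code r (tnth (tau j w) i) | i < K]) => //; split; last first.
    by split=> // i; rewrite tnth_mktuple.
  exists (y w); split=> // [i|]; first by rewrite yE tnth_mktuple.
  by rewrite -spine_fromE.
- rewrite spine_fromE; apply/(@children_codeE r s c (y w)) => // i.
  by rewrite yE wt.
Qed.

Lemma measurable_prop (Q : Prop) : measurable [set w : Om | Q].
Proof.
have [q|nq] := pselect Q.
  by rewrite (_ : [set w | Q] = setT)//; apply/seteqP; split.
by rewrite (_ : [set w | Q] = set0)//; apply/seteqP; split.
Qed.

Lemma measurable_spine_code r j s :
  measurable [set w | ball_code r (spine_from j w) = s].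
Proof.
elim: r j s => [|r IH] j s.
  rewrite (_ : [set w | _] = [set w : Om | ball_code 0 (tree_of leaf) = s]).
    exact: measurable_prop.
  by apply/seteqP; split=> w /= <-; apply/codeP; rewrite !restr0.
rewrite spine_code_bigcup; apply: countable_bigcupT_measurable => [|c].
  exact: countableP.
apply: measurableI; first exact: measurable_prop.
by apply: measurableI => //; exact: measurable_tau_code.
Qed.

Local Notation TT := (K.-tuple nat * K.-tuple T)%type.

(** The information on [(X j, tau j)] that the induction on the radius uses. *)
Definition step_event r (m c : K.-tuple nat) : set TT :=
  [set z | z.1 = m /\ forall i, ball_code r (tnth z.2 i) = tnth c i].

Lemma measurable_step_event r m c : measurable (step_event r m c).
Proof.
have -> : step_event r m c =
    (\bigcap_(i in [set: 'I_K]) (fst @^-1` ((fun x => tnth x i) @^-1` [set tnth m i])))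
    `&` (\bigcap_(i in [set: 'I_K])
      (snd @^-1` ((fun x : K.-tuple T => tnth x i) @^-1` cyl r (tnth c i)))).
  apply/seteqP; split=> [[x y]/= [/= xm h]|[x y] [h1 h2]].
    by split=> [i _|i _]; [rewrite /= xm|exact: h].
  by split=> /= [|i]; [apply: eq_from_tnth => i; exact: (h1 i)|exact: (h2 i)].
apply: measurableI; apply: fin_bigcap_measurable => // i _;
  rewrite -[X in measurable X]setTI.
  apply: measurable_fst => //; rewrite -[X in measurable X]setTI.
  exact: (measurable_tnth i).
apply: measurable_snd => //; rewrite -[X in measurable X]setTI.
by apply: (measurable_tnth (T := T) i) => //; exact: measurable_cyl.
Qed.

Hypothesis indep : independent_seq P (fun n w => (X n w, tau n w)).
Hypothesis XE : forall n m, P (X n @^-1` [set m]) =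
  (neg_dirichlet_multinomial R (m : k.-1.-tuple nat))%:E.
Hypothesis tauE : forall n m (A : 'I_K -> set T), (forall i, measurable (A i)) ->
  fine (P (X n @^-1` [set m] `&` [set w | forall i, A i (tnth (tau n w) i)])) =
  fine (P (X n @^-1` [set m])) * \prod_(i < K) fine (GT k (tnth m i) (A i)).

(** Events on the first [j] vertices of the branch. Carrying them along in the
    induction replaces a product formula for the whole branch. *)
Definition past j (B : nat -> set TT) : set Om :=
  \bigcap_(l in `I_j) (fun w => (X l w, tau l w)) @^-1` B l.

Lemma measurable_past j (B : nat -> set TT) : (forall l, measurable (B l)) ->
  measurable (past j B).
Proof.
move=> mB; apply: fin_bigcap_measurable; first exact: finite_II.
move=> l _; rewrite -[X in measurable X]setTI.
by apply: measurable_fun_pair.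
Qed.

Lemma past_prod j (B : nat -> set TT) : (forall l, measurable (B l)) ->
  fine (P (past j B)) =
  \prod_(l < j) fine (P ((fun w => (X l w, tau l w)) @^-1` B l)).
Proof.
move=> mB; have := indep [fset l | l in iota 0 j]%fset mB.
have -> : [set` [fset l | l in iota 0 j]%fset] = `I_j.
  by apply/seteqP; split=> l /=; rewrite !inE mem_iota.
move=> ->; rewrite (perm_big (iota 0 j)); last first.
  apply: uniq_perm; [exact: fset_uniq|exact: iota_uniq|] => l.
  by rewrite !inE.
by rewrite -[RHS](big_mkord xpredT
  (fun l => fine (P ((fun w => (X l w, tau l w)) @^-1` B l)))) /index_iota subn0.
Qed.

Definition cyl_indic r s : ptree -> R := fun t => \1_(cyl r s) (tree_of t : loctree R).

Lemma past_stepE j (B : nat -> set TT) r m c :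
  past j.+1 (fun l => if l == j then step_event r m c else B l) =
  past j B `&` (X j @^-1` [set m] `&` tau_code r j c).
Proof.
apply/seteqP; split=> [w wB|w [wB [wm wc]] l /=].
  split; last first.
    by have := wB j (ltnSn j); rewrite /= eqxx => -[].
  move=> l /= lj; have := wB l (ltnW lj : (l < j.+1)%N).
  by rewrite /= ltn_eqF.
rewrite ltnS leq_eqVlt; case: eqVneq => [-> _|_ /= lj]; first by split.
exact: (wB l lj).
Qed.

(** Independence of the vertices of the branch, with the law of [(X j, tau j)]. *)
Lemma past_step j (B : nat -> set TT) r m c : (forall l, measurable (B l)) ->
  fine (P (past j.+1 (fun l => if l == j then step_event r m c else B l))) =
  fine (P (past j B)) * (neg_dirichlet_multinomial R (m : k.-1.-tuple nat) *
    \prod_(i < K) gexp K (tnth m i) (cyl_indic r (tnth c i))).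
Proof.
move=> mB; rewrite !past_prod// => [|l]; last first.
  by case: ifP => // _; exact: measurable_step_event.
rewrite big_ord_recr/= eqxx; congr (_ * _).
  by apply: eq_bigr => l _; rewrite ltn_eqF.
rewrite (eq_bigr (fun i => fine (GT k (tnth m i) (cyl r (tnth c i) : set T)))).
  by have := tauE j m (fun i => measurable_cyl r (tnth c i)); rewrite XE.
by move=> i _; rewrite GT_gexp.
Qed.

Local Notation subtree_prod r c :=
  (child_prod (cyl_indic r c.1) (fun i => cyl_indic r (tnth c.2 i))).

Definition subtree_codes r (c : nat * K.-tuple nat) : set ptree :=
  [set t | ball_code r (tree_of (child t 0)) = c.1 /\
           forall i : 'I_K, ball_code r (tree_of (child t i.+1)) = tnth c.2 i].

(** Products of indicators, so that [gexp_child_prod] applies to them. *)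
Lemma subtree_prodE r c t : subtree_prod r c t = \1_(subtree_codes r c) t.
Proof.
rewrite /child_prod /cyl_indic; have [[t0 ti]|nt] := pselect (subtree_codes r c t).
  rewrite [RHS]indicE mem_set// indicE mem_set// mul1r big1// => i _.
  by rewrite indicE mem_set//; exact: ti.
rewrite [RHS]indicE memNset// indicE.
have [t0|t0] := pselect (cyl r c.1 (tree_of (child t 0) : loctree R)); last first.
  by rewrite memNset// mul0r.
have [i ti] : exists i : 'I_K, ball_code r (tree_of (child t i.+1)) <> tnth c.2 i.
  by apply: contra_notP nt => /forallNP nt; split=> // i; exact: contrapT.
by rewrite (bigD1 i)//= indicE [_ \in cyl r (tnth _ _)]memNset// mul0r mulr0.
Qed.

Lemma sum_subtree_prod_le n r s (F : seq (nat * K.-tuple nat)) : uniq F ->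
  \sum_(c <- F) `[< children_code r s c >]%:R * gexp K n.+1 (subtree_prod r c)
  <= gexp K n.+1 (cyl_indic r.+1 s).
Proof.
move=> uF; rewrite (eq_bigr (fun c => gexp K n.+1 (fun t =>
    `[< children_code r s c >]%:R * subtree_prod r c t))); last first.
  by move=> c _; rewrite gexpZ.
rewrite -gexp_sum; apply: ler_gexp => p pn.
pose D c : set ptree := [set t | children_code r s c] `&` subtree_codes r c.
rewrite (eq_bigr (fun c => \1_(D c) p.2)); last first.
  move=> c _; rewrite subtree_prodE; case: asboolP => cs.
    by rewrite mul1r /D (_ : [set t | _] = setT) ?setTI//; apply/seteqP; split.
  by rewrite mul0r indicE memNset// => -[].
(* Grown trees have [k] children at the root, the others need not obey [s]. *)
pose U : set ptree := [set t | t [::] = k -> ball_code r.+1 (tree_of t) = s].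
have -> : cyl_indic r.+1 s p.2 = \1_U p.2.
  rewrite /cyl_indic !indicE; congr (_%:R); congr nat_of_bool.
  apply/idP/idP; rewrite !inE /U /cyl /=; first by move=> ->.
  by apply; exact: growth_root pn.
apply: sum_indic_le => //.
- move=> [c0 c] [c0' c'] _ _ [t [[_ [/= t0 ti]] [_ [/= t0' ti']]]].
  by congr pair; [rewrite -t0 -t0'|apply: eq_from_tnth => i; rewrite -ti -ti'].
- move=> c t [/= cs [t0 ti]] tk; rewrite (node_child t) tk tree_of_node.
  by apply/(@children_codeE r s c (fun i => tree_of (child t i))).
Qed.

(** By induction on the radius, for all [j] and all events [past j B] at once. The
    codes [c] of the balls at the children of [v_j] and the sizes [m] of the
    trees [tau j] split the event into countably many pieces. On each piece the
    conditions on [tau j] are absorbed into [past j.+1], and the induction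
    hypothesis applies to the subtree above [v_(j+1)]. For the grown tree,
    [gexp_child_prod] gives the matching terms: the weight of [m] is controlled
    by [lowlim_sexp], and the size [n - total_size m] of the first subtree still
    tends to infinity. *)
Lemma lowlim_spine r j s (B : nat -> set TT) : (forall l, measurable (B l)) ->
  lowlim (fun n => fine (P (past j B)) * gexp K n (cyl_indic r s))
    (fine (P (past j B `&` [set w | ball_code r (spine_from j w) = s]))).
Proof.
elim: r j s B => [|r IH] j s B mB.
  have mpast := measurable_past j mB.
  have [c0|c0] := eqVneq (ball_code 0 (tree_of leaf)) s.
    apply: lowlim_ge => n; rewrite (_ : gexp K n _ = 1) ?mulr1.
      have mI := measurableI _ _ mpast (measurable_spine_code 0 j s).
      by rewrite fine_le ?fin_num_measure//; apply: le_measure; rewrite ?inE.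
    rewrite -[RHS](gexp_cst K n 1); apply: eq_gexp => p _.
    by rewrite /cyl_indic indicE mem_set// /cyl /= -c0; apply/codeP; rewrite !restr0.
  rewrite (_ : _ `&` _ = set0) ?measure0.
    by apply: lowlim_ge => n; rewrite mulr_ge0 ?gexp_ge0// ?fine_ge0.
  rewrite -subset0 => w [_ /= ws]; move/eqP: c0; apply; rewrite -ws.
  by apply/codeP; rewrite !restr0.
(* The root of a grown tree has children from the first step on. *)
apply: lowlim_shift; rewrite spine_code_bigcup setI_bigcupr.
have p0 : 0 <= fine (P (past j B)) by rewrite fine_ge0.
apply: (@lowlim_bigcup _ _ _ _ _ _ _ (fun c n => fine (P (past j B)) *
    (`[< children_code r s c >]%:R * gexp K n.+1 (subtree_prod r c)))).
- move=> c; apply: measurableI; first exact: measurable_past.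
  apply: measurableI; first exact: measurable_prop.
  apply: measurableI; first exact: measurable_tau_code.
  exact: measurable_spine_code.
- move=> [c0 c] [c0' c'] _ _ [w [[_ [_ [/= t0 ti]]] [_ [_ [/= t0' ti']]]]].
  by congr pair; [rewrite -ti -ti'|apply: eq_from_tnth => i; rewrite -t0 -t0'].
- by move=> n F uF; rewrite -mulr_sumr ler_wpM2l//; exact: sum_subtree_prod_le.
move=> c; case: asboolP => [cs|ncs]; last first.
  rewrite (_ : _ `&` _ = set0) ?measure0; last by rewrite -subset0 => w [_ []].
  by apply: lowlim_ge => n; rewrite mul0r mulr0.
(* For fixed codes, the event is split further by the sizes. *)
pose D m := past j.+1 (fun l => if l == j then step_event r m c.2 else B l) `&`
  [set w | ball_code r (spine_from j.+1 w) = c.1].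
have -> : past j B `&` ([set _ | children_code r s c] `&`
    (tau_code r j c.2 `&` [set w | ball_code r (spine_from j.+1 w) = c.1])) =
    \bigcup_m D m.
  rewrite /D; under eq_bigcupr do rewrite past_stepE.
  apply/seteqP; split=> [w [wB [_ [wt ws]]]|w [m _ [[wB [_ wt]] ws]]] //=.
  by exists (X j w).
pose pr m := \prod_(i < K) gexp K (tnth m i) (cyl_indic r (tnth c.2 i)).
apply: (@lowlim_bigcup _ _ _ _ _ _ _ (fun m n => fine (P (past j B)) * pr m *
   (sexp n (at_size R m) * gexp K (n - total_size m) (cyl_indic r c.1)))).
- move=> m; apply: measurableI; last exact: measurable_spine_code.
  apply: measurable_past => l; case: ifP => // _.
  exact: measurable_step_event.
- move=> m m' _ _ [w [[+ _] [+ _]]]; rewrite !past_stepE.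
  by move=> [_ [/= <- _]] [_ [/= <- _]].
- move=> n F uF; rewrite mul1r gexp_child_prod.
  rewrite (eq_bigr (fun m => fine (P (past j B)) * (sexp n (at_size R m) *
      (gexp K (n - total_size m) (cyl_indic r c.1) * pr m)))); last first.
    by move=> m _; ring.
  rewrite -mulr_sumr ler_wpM2l//; apply: sexp_sum_le => // m.
  by rewrite mulr_ge0 ?gexp_ge0// prodr_ge0// => i _; rewrite gexp_ge0.
move=> m; apply: (@lowlim_mul _ _ _
  (neg_dirichlet_multinomial R (m : k.-1.-tuple nat))).
- by rewrite mulr_ge0// prodr_ge0// => i _; rewrite gexp_ge0.
- move=> n; apply/andP; split; [apply: gexp_ge0|apply: gexp_le1] => t //.
  by rewrite /cyl_indic indicE lern1 leq_b1.
- exact: lowlim_sexp.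
apply: (@lowlim_subn _ (total_size m) (fun n => fine (P (past j B)) * pr m *
  neg_dirichlet_multinomial R (m : k.-1.-tuple nat) * gexp K n (cyl_indic r c.1))).
have mB' l : measurable (if l == j then step_event r m c.2 else B l).
  by case: ifP => // _; exact: measurable_step_event.
apply: lowlim_le (IH j.+1 c.1 _ mB') => // n.
by rewrite past_step// le_eqVlt; apply/orP; left; apply/eqP; rewrite /pr; ring.
Qed.

End limit_tree.

(** * From balls to open sets *)

Lemma lowlim_cyl (R : realType) K (mu : probability (borel (loctree R)) R) r s :
  is_GT_infinity K.+1 mu ->
  lowlim (fun n => fine (GT K.+1 n (cyl r s : set (borel (loctree R)))))
    (fine (mu (cyl r s))).
Proof.
move=> [d [Om [P [X [tau [indep XE tauE muE]]]]]].
have := @lowlim_spine R K d Om P X tau indep XE tauE r 0 s (fun=> setT)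
  (fun=> measurableT).
rewrite muE; last exact: measurable_cyl.
have -> : past X tau 0 (fun=> setT) = setT by apply/seteqP; split.
rewrite setTI; apply: lowlim_le => // n.
by rewrite probability_setT/= mul1r GT_gexp.
Qed.

Section portmanteau.
Variables (R : realType) (K : nat) (mu : probability (borel (loctree R)) R).
Local Notation T := (borel (loctree R)).
Local Notation nu n := (GT K.+1 n : probability T R).
Hypothesis lowlim_mu : forall r s,
  lowlim (fun n => fine (nu n (cyl r s))) (fine (mu (cyl r s))).

Let nuE n (A : set T) :
  fine (nu n A) = gexp K n (fun t => \1_A (tree_of t : T)).
Proof. exact: (congr1 fine (GT_gexp K n A)). Qed.

(** An open set is the disjoint union of the maximal cylinders that it contains,
    and there are only countably many cylinders. *)
Lemma lowlim_open (U : set (loctree R)) : open U ->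
  lowlim (fun n => fine (nu n U)) (fine (mu U)).
Proof.
move=> oU.
pose good r x := cyl r (ball_code r x) `<=` U.
(* [D (r, i)] is the cylinder [cyl r i] if this is maximal in [U], else empty. *)
pose D (c : nat * nat) : set T := [set x | [/\ ball_code c.1 x = c.2, good c.1 x &
  forall r, (r < c.1)%N -> ~ good r x]].
have DE c : D c = set0 \/ D c = cyl c.1 c.2.
  have [[x [xc gx mx]]|nD] := pselect (exists x, D c x); [right|left].
    apply/seteqP; split=> [y []//|y /= yc]; split=> //.
      by rewrite /good yc -xc.
    move=> r rc; have := mx r rc; rewrite /good.
    have -> // : ball_code r y = ball_code r x.
    by apply: (@code_nested c.1); rewrite ?(ltnW rc) ?yc ?xc.
  by rewrite -subset0 => x Dx; apply: nD; exists x.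
have mD c : measurable (D c).
  by have [->|->] := DE c => //; exact: measurable_cyl.
have tD : trivIset [set: nat * nat] D.
  move=> [r i] [r' i'] _ _ [x [[/= xi gx mx] [/= xi' gx' mx']]].
  have rr : r = r'.
    apply/eqP; rewrite eqn_leq; apply/andP; split; rewrite leqNgt; apply/negP => lt.
      exact: (mx _ lt).
    exact: (mx' _ lt).
  by rewrite -xi -xi' rr.
have UE : U = \bigcup_c D c.
  apply/seteqP; split=> [x Ux|x [c _ [xc gx _]]]; last by apply: gx.
  have [r0 r0U] := nbhs_cyl (open_nbhs_nbhs (conj oU Ux)).
  have exg : exists r, `[< good r x >] by exists r0; apply/asboolP.
  have := ex_minnP exg; move=> [r /asboolP gr minr].
  exists (r, ball_code r x) => //; split=> // r' /= r'r /asboolP /minr.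
  by rewrite leqNgt r'r.
have mU : measurable (U : set T) by exact: sub_sigma_algebra.
rewrite [X in lowlim _ (fine (mu X))]UE.
apply: (@lowlim_bigcup _ _ _ _ _ _ _ (fun c n => fine (nu n (D c)))) => //.
- move=> n F uF; rewrite nuE (eq_bigr _ (fun c _ => nuE n (D c))).
  rewrite -gexp_sum; apply: ler_gexp => p _; apply: sum_indic_le => // c.
  by rewrite UE; exact: bigcup_sup.
- move=> c; have [->|->] := DE c; last exact: lowlim_mu.
  by apply: lowlim_ge => n; rewrite !measure0.
Qed.

End portmanteau.

Section layer_cake.
Variables (R : realType) (T : Type) (f : T -> R) (e : R).
Hypothesis f0 : forall x, 0 <= f x.

(** A combination of indicators of open level sets that approximates [f] from
    below to within [e]. *)
Definition staircase M (x : T) : R :=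
  \sum_(j < M) e * \1_[set x | j.+1%:R * e < f x] x.

Lemma staircase_le M x : staircase M x <= f x /\ staircase M x <= M%:R * e.
Proof.
rewrite /staircase; elim: M => [|M [IH1 IH2]]; first by rewrite big_ord0 mul0r.
rewrite big_ord_recr /= indicE; case: (ltP (M.+1%:R * e) (f x)) => h.
  by rewrite mem_set//=; move: h; rewrite -natr1; split; lra.
rewrite memNset; last by move=> /= lt; move: h; rewrite leNgt lt.
rewrite mulr0 addr0 -natr1; split=> //; lra.
Qed.

Lemma staircase_ge M x : f x <= M.+1%:R * e -> f x <= staircase M x + e.
Proof.
suff : Num.min (f x) (M.+1%:R * e) <= staircase M x + e.
  by move=> h fM; move: h; rewrite (min_idPl fM).
rewrite /staircase; elim: M => [|M IH].
  by rewrite big_ord0 add0r mul1r ge_min lexx orbT.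
rewrite big_ord_recr /= indicE; case: (ltP (M.+1%:R * e) (f x)) => h.
  rewrite mem_set//= ge_min; apply/orP; right; move: IH.
  rewrite (min_idPr (ltW h)) -[M.+2%:R]natr1; lra.
rewrite memNset; last by move=> /= lt; move: h; rewrite leNgt lt.
rewrite mulr0 addr0; move: IH; rewrite (min_idPl h) => h'.
by rewrite ge_min h'.
Qed.

End layer_cake.

(** * From open sets to integrals *)

Section integrals.
Variables (R : realType).
Local Notation T := (borel (loctree R)).
Implicit Types (nu : probability T R) (f g : loctree R -> R).

Lemma measurable_fun_borel f : continuous f ->
  measurable_fun [set: T] (f : T -> R).
Proof.
move=> cf; apply: (measurability (@RGenOInfty.G R)).
  exact: RGenOInfty.measurableE.
move=> _ [_ [x ->] <-]; rewrite setTI; apply: sub_sigma_algebra.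
by move/continuousP : cf; apply; exact: interval_open.
Qed.

Lemma integrable_borel nu (g : T -> R) (C : R) : measurable_fun [set: T] g ->
  (forall x, `|g x| <= C) -> nu.-integrable [set: T] (EFin \o g).
Proof.
move=> mg gC; apply: measurable_bounded_integrable => //.
  by rewrite ltey_eq fin_num_measure.
by exists C; split=> [|y Cy x _]; [exact: num_real|exact: le_trans (gC x) (ltW Cy)].
Qed.

Lemma open_level f (c : R) : continuous f -> open [set x | c < f x].
Proof.
move=> /continuousP cf; rewrite (_ : [set x | _] = f @^-1` `]c, +oo[%classic).
  by apply: cf; exact: interval_open.
by apply/seteqP; split=> x /=; rewrite in_itv/= andbT.
Qed.

Variables (f : loctree R -> R) (e : R).
Hypotheses (e0 : 0 < e) (f0 : forall x, 0 <= f x) (cf : continuous f).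

Let level j : set T := [set x | j.+1%:R * e < f x].

Let mlevel j : measurable (level j).
Proof. by apply: sub_sigma_algebra; exact: open_level. Qed.

Let mstair M : measurable_fun [set: T] (staircase f e M : T -> R).
Proof.
rewrite /staircase; apply: measurable_sum => j; apply: measurable_funM => //.
exact: (@measurable_indic _ T R setT (level j) (mlevel j)).
Qed.

Let bstair M (x : loctree R) : `|staircase f e M x| <= M%:R * e.
Proof.
rewrite ger0_norm; first by have [] := staircase_le e f0 M x.
by apply: sumr_ge0 => j _; rewrite indicE mulr_ge0 ?(ltW e0).
Qed.

Lemma Rintegral_staircase nu M :
  \int[nu]_x (staircase f e M x) = \sum_(j < M) e * fine (nu (level j)).
Proof.
elim: M => [|M IH].
  rewrite big_ord0 (_ : (fun x => _) = cst 0) ?Rintegral_cst ?mul0r//.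
  by apply/funext => x; rewrite /staircase big_ord0.
have mi : measurable_fun [set: T] (\1_(level M) : T -> R) by exact: measurable_indic.
have ii : nu.-integrable [set: T] (EFin \o (\1_(level M) : T -> R)).
  apply: (@integrable_borel _ _ 1) => // x; rewrite indicE.
  by case: (_ \in _); rewrite ?normr1 ?normr0.
rewrite (_ : (fun x => staircase f e M.+1 x) =
  (fun x => staircase f e M x + e * \1_(level M) x)); last first.
  by apply/funext => x; rewrite /staircase big_ord_recr.
rewrite RintegralD//; first last.
- apply: (@integrable_borel _ _ e); first exact: measurable_funM.
  move=> x; rewrite /= indicE; case: (_ \in _).
    by rewrite mulr1 ger0_norm ?(ltW e0).
  by rewrite mulr0 normr0 (ltW e0).
- exact: integrable_borel (mstair M) (bstair M).
rewrite IH big_ord_recr /=; congr (_ + _).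
by rewrite RintegralZl// /Rintegral (integral_indic nu measurableT (mlevel M)) setIT.
Qed.

Lemma Rintegral_levels nu M : (forall x, f x <= M.+1%:R * e) ->
  \sum_(j < M) e * fine (nu (level j)) <= \int[nu]_x f x <=
  \sum_(j < M) e * fine (nu (level j)) + e.
Proof.
move=> fM; rewrite -Rintegral_staircase.
have fi : nu.-integrable [set: T] (EFin \o (f : T -> R)).
  apply: (@integrable_borel _ _ (M.+1%:R * e)); first exact: measurable_fun_borel.
  by move=> x; rewrite ger0_norm.
have si := integrable_borel nu (mstair M) (bstair M).
have ei : nu.-integrable [set: T] (EFin \o (cst e : T -> R)).
  by apply: (@integrable_borel _ _ e) => // x; rewrite ger0_norm// ltW.
apply/andP; split.
  by apply: le_Rintegral => // x _; have [] := staircase_le e f0 M x.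
have -> : \int[nu]_x staircase f e M x + e = \int[nu]_x (staircase f e M x + e).
  rewrite RintegralD// Rintegral_cst//; congr (_ + _).
  rewrite -[LHS]mulr1; congr (_ * _).
  exact/esym/(congr1 fine (probability_setT nu)).
apply: le_Rintegral => //; last by move=> x _; exact: staircase_ge.
apply: (@integrable_borel _ _ (M%:R * e + e)); first exact: measurable_funD.
by move=> x; rewrite (le_trans (ler_normD _ _))// lerD// ger0_norm// ltW.
Qed.

End integrals.

(** The integral of [f] is, up to [e / 2], a finite combination of the measures
    of open level sets, with the same error for all the measures. *)
Lemma lowlim_Rintegral (R : realType) (mu_ : nat -> probability (borel (loctree R)) R)
    (mu : probability (borel (loctree R)) R) (f : loctree R -> R) (C : R) :
  (forall U : set (loctree R), open U ->
    lowlim (fun n => fine (mu_ n U)) (fine (mu U))) ->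
  continuous f -> (forall x, 0 <= f x <= C) ->
  lowlim (fun n => \int[mu_ n]_x f x) (\int[mu]_x f x).
Proof.
move=> muU cf f0C e e0; have e20 : 0 < e / 2 by rewrite divr_gt0.
have f0 x : 0 <= f x by have /andP[] := f0C x.
pose M := Num.truncn (C / (e / 2)).
have fM x : f x <= M.+1%:R * (e / 2).
  have /andP[_ /le_trans] := f0C x; apply.
  by rewrite -ler_pdivrMr// ltW// truncnS_gt.
have : lowlim
    (fun n => \sum_(j < M) e / 2 * fine (mu_ n [set x | j.+1%:R * (e / 2) < f x]))
    (\sum_(j < M) e / 2 * fine (mu [set x | j.+1%:R * (e / 2) < f x])).
  by apply: lowlim_sum => j; apply: lowlimZ; [exact: ltW|apply: muU; exact: open_level].
move=> /(_ _ e20)[N NP]; exists N => n /NP.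
have /andP[h1 _] := Rintegral_levels e20 f0 cf (mu_ n) fM.
have /andP[_ h2] := Rintegral_levels e20 f0 cf mu fM.
move: h1 h2; lra.
Qed.

Lemma lowlim_cvg (R : realType) (a : nat -> R) (L : R) :
  lowlim a L -> lowlim (fun n => - a n) (- L) -> a n @[n --> \oo] --> L.
Proof.
move=> aL aNL; apply/cvgrPdist_le => e e0.
have [N NP] := aL e e0; have [N' NP'] := aNL e e0.
exists (maxn N N') => // n /=; rewrite geq_max => /andP[/NP h /NP' h'].
by rewrite ler_norml; apply/andP; split; move: h h'; lra.
Qed.

Lemma continuous_affine (R : realType) (T : topologicalType) (c C : R) (f : T -> R) :
  continuous f -> continuous (fun x => c * f x + C).
Proof.
move=> cf x; apply: cvgD; last exact: cvg_cst.
by apply: cvgM; [exact: cvg_cst|exact: cf].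
Qed.

Theorem proposition5p17 (R : realType) (k : nat) (hk : (2 <= k)%N)
    (GT_infinity : probability (borel (loctree R)) R)
    (hGT : is_GT_infinity k GT_infinity) :
  weakly_converges (fun n : nat => GT k n) GT_infinity.
Proof.
case: k hk hGT => // K _ hGT f cf bf.
have muU := lowlim_open (fun r s => lowlim_cyl r s hGT).
have [C fC] : exists C : R, forall x, `|f x| <= C.
  by have [M [_ Mf]] := bf; exists (M + 1) => x; apply: Mf => //; rewrite ltrDl.
have mf := measurable_fun_borel cf.
have fi (nu : probability (borel (loctree R)) R) :=
  integrable_borel nu mf fC.
have intE (nu : probability (borel (loctree R)) R) :
    (\int[nu]_x (f x)%:E = (\int[nu]_x f x)%R%:E)%E.
  by rewrite fineK//; exact: (integrable_fin_num measurableT (fi nu)).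
have ci (nu : probability (borel (loctree R)) R) :
    nu.-integrable setT (EFin \o (cst C : borel (loctree R) -> R)).
  by apply: (@integrable_borel _ _ _ `|C|).
have cE (nu : probability (borel (loctree R)) R) : \int[nu]_x (cst C x) = C.
  rewrite Rintegral_cst// -[RHS]mulr1; congr (_ * _).
  exact: (congr1 fine (probability_setT nu)).
(* [lowlim_Rintegral] is for nonnegative functions, hence the shift by [C]. *)
have f0 x : 0 <= 1 * f x + C <= C + C.
  by have := fC x; rewrite ler_norml => /andP[]; lra.
have f1 x : 0 <= -1 * f x + C <= C + C.
  by have := fC x; rewrite ler_norml => /andP[]; lra.
have cfi (nu : probability (borel (loctree R)) R) (c : R) :
    nu.-integrable setT (EFin \o ((fun x => c * f x) : borel (loctree R) -> R)).
  apply: (@integrable_borel _ _ _ (`|c| * C)).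
    exact: (measurable_funM (measurable_cst c) mf).
  by move=> x; rewrite normrM ler_wpM2l.
have affE (nu : probability (borel (loctree R)) R) (c : R) :
    \int[nu]_x (c * f x + C) = c * \int[nu]_x f x + C.
  rewrite (RintegralD measurableT (cfi nu c) (ci nu)).
  by rewrite (RintegralZl c measurableT (fi nu)) cE.
have c0 := @continuous_affine R _ 1 C f cf.
have c1 := @continuous_affine R _ (-1) C f cf.
rewrite intE; under eq_fun do rewrite intE.
apply: cvg_EFin; first by near=> n.
have cstC (c : R) : lowlim (fun=> c) c by exact: lowlim_ge.
apply: lowlim_cvg.
- have := lowlimD (lowlim_Rintegral muU c0 f0) (cstC (- C)).
  by apply: lowlim_le => [|n]; rewrite affE mul1r addrK.
- have := lowlimD (lowlim_Rintegral muU c1 f1) (cstC (- C)).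
  by apply: lowlim_le => [|n]; rewrite affE mulN1r addrK.
Unshelve. all: by end_near. Qed.
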